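(* Let $w:\mathbb N\to(0,\infty)$ be a weight function. The eigenvalues of the biased one-sided transposition shuffle $\overline{\mathrm{OST}}_{n,w}$ on the hyperoctahedral group $B_n$ are indexed by standard Young (bi-)tableaux of shape $\overline\lambda\vdash n$, and the eigenvalue represented by a tableau of shape $\overline\lambda$ has multiplicity $d_{\overline\lambda}$. For a standard Young tableau $\overline T=(T^1,T^2)$ of shape $\overline\lambda$ the eigenvalue corresponding to $\overline T$ is $$\mathrm{eig}(\overline T)=\frac1{N_w(n)}\left(\sum_{(i,j)\in T^1}\frac{j-i+1}{T^1(i,j)}\,w\bigl(T^1(i,j)\bigr)+\sum_{(i,j)\in T^2}\frac{j-i}{T^2(i,j)}\,w\bigl(T^2(i,j)\bigr)\right).$$ (If several tableaux give the same value, their multiplicities add.)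
   Context: $B_n$ is the group (under composition) of all bijections $\sigma$ of $\{\pm1,\dots,\pm n\}$ with $\sigma(-i)=-\sigma(i)$, containing $S_n$ as those $\sigma$ with $\sigma(i)>0$ for $i>0$. $\xi_i\in B_n$ swaps $i$ and $-i$ and fixes all $j\neq\pm i$. With $N_w(n)=\sum_{k=1}^nw(k)$, $\overline{\mathrm{OST}}_{n,w}$ is the random walk on $B_n$ driven by the distribution: $\overline{\mathrm{OST}}_{n,w}(e)=\frac1{2N_w(n)}\sum_{j=1}^n\frac{w(j)}j$; $\overline{\mathrm{OST}}_{n,w}(\xi_j)=\frac{w(j)}{N_w(n)}\frac1{2j}$ for $1\le j\le n$; $\overline{\mathrm{OST}}_{n,w}((i\,j))=\overline{\mathrm{OST}}_{n,w}(\xi_i\xi_j(i\,j))=\frac{w(j)}{N_w(n)}\frac1{2j}$ for $1\le i<j\le n$; and $0$ elsewhere. Its eigenvalues are those of the transition matrix $P(g,h)=\overline{\mathrm{OST}}_{n,w}(hg^{-1})$, $g,h\in B_n$. A bi-partition $\overline\lambda=(\lambda^1,\lambda^2)\vdash n$ is a pair of (possibly empty) partitions with $|\lambda^1|+|\lambda^2|=n$. A standard Young tableau $\overline T=(T^1,T^2)$ of shape $\overline\lambda$ is a filling of the boxes of the two Young diagrams ($T^k$ fills $\lambda^k$) by $1,\dots,n$, each used exactly once in total, increasing along rows and down columns within each diagram; $T^k(i,j)$ is the entry in row $i$, column $j$ of $T^k$. $d_{\overline\lambda}$ is the number of standard Young tableaux of shape $\overline\lambda$. *)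

(* Defs.v *)
From mathcomp Require Import all_boot all_order all_algebra all_fingroup.

Set Implicit Arguments.
Unset Strict Implicit.
Unset Printing Implicit Defensive.

Import Order.TTheory GRing.Theory Num.Theory.

(* (false, i) stands for i + 1 and (true, i) for - (i + 1), so that
   [signed n] is {1, ..., n, -1, ..., -n}. *)
Definition signed (n : nat) : finType := (bool * 'I_n)%type.

Definition sopp n (x : signed n) : signed n := (~~ x.1, x.2).

Definition hyperoct (n : nat) : {set {perm signed n}} :=
  [set s : {perm signed n} | [forall x, s (sopp x) == sopp (s x)]].

Lemma hyperoct_group_set n : group_set (hyperoct n).
Proof.
apply/group_setP; split=> [|s t]; rewrite !inE.
  by apply/forallP=> x; rewrite !perm1.
move=> /forallP sP /forallP tP; apply/forallP=> x.
by rewrite !permM (eqP (sP x)) (eqP (tP _)).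
Qed.
Canonical hyperoct_group n := Group (@hyperoct_group_set n).

Definition sym_signed n (s : 'S_n) (x : signed n) : signed n := (x.1, s x.2).

Lemma sym_signed_inj n (s : 'S_n) : injective (sym_signed s).
Proof. by move=> [a i] [b j] [-> /perm_inj ->]. Qed.

(* The inclusion of S_n in B_n. *)
Definition sym_perm n (s : 'S_n) : {perm signed n} := perm (@sym_signed_inj n s).

Definition xi n (i : 'I_n) : {perm signed n} := tperm (false, i) (true, i).

Definition transp n (i j : 'I_n) : {perm signed n} := sym_perm (tperm i j).

(* The composite xi_i o xi_j o (i j): in [s * t] the permutation [s] acts
   first. *)
Definition neg_transp n (i j : 'I_n) : {perm signed n} :=
  (transp i j * xi j * xi i)%g.

Local Open Scope ring_scope.

Section Shuffle.
Variables (R : realFieldType) (w : nat -> R) (n : nat).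

Definition total_weight : R := \sum_(1 <= k < n.+1) w k.

(* An index j : 'I_n stands for the integer j + 1. *)
Definition ost_rate (j : 'I_n) : R :=
  w j.+1 / total_weight * (2 * j.+1%:R)^-1.

(* A sum of point masses; its atoms are pairwise distinct, so these are the
   values of the distribution, see [ost1] to [ost_out]. *)
Definition ost (g : {perm signed n}) : R :=
    (g == 1%g)%:R * ((2 * total_weight)^-1 * \sum_(j < n) w j.+1 / j.+1%:R)
  + \sum_(j < n) (g == xi j)%:R * ost_rate j
  + \sum_(j < n) \sum_(i < n | (i < j)%N)
      ((g == transp i j)%:R + (g == neg_transp i j)%:R) * ost_rate j.

(* P(g, h) = ost (h o g^-1), where h o g^-1 is [g^-1 * h] since in [s * t] the
   permutation [s] acts first. *)
Definition ost_matrix : 'M[R]_#|hyperoct n| :=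
  \matrix_(g, h) ost ((enum_val g)^-1 * enum_val h)%g.

Lemma xiE (i : 'I_n) x : xi i x = (x.1 (+) (x.2 == i), x.2).
Proof.
case: x => b k; rewrite /xi /=; case: tpermP => [[-> ->]|[-> ->]|] /=.
- by rewrite eqxx.
- by rewrite eqxx.
by case: (eqVneq k i) => [->|]; case: b => //=.
Qed.

Lemma transpE (i j : 'I_n) x : transp i j x = (x.1, tperm i j x.2).
Proof. by rewrite permE. Qed.

Lemma neg_transpE (i j : 'I_n) x : i != j ->
  neg_transp i j x = (x.1 (+) ((x.2 == i) || (x.2 == j)), tperm i j x.2).
Proof.
move=> ne; rewrite !permM transpE !xiE /=; congr pair.
by case: tpermP => [->|->|/eqP/negbTE-> /eqP/negbTE->] /=;
  rewrite ?eqxx ?(negbTE ne) 1?eq_sym ?(negbTE ne) ?orbT ?addbF.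
Qed.

Lemma xi_hyperoct (i : 'I_n) : xi i \in hyperoct n.
Proof. by rewrite inE; apply/forallP=> x; rewrite !xiE /sopp /= addNb. Qed.

Lemma sym_perm_hyperoct (s : 'S_n) : sym_perm s \in hyperoct n.
Proof. by rewrite inE; apply/forallP=> x; rewrite !permE. Qed.

Lemma neg_transp_hyperoct (i j : 'I_n) : neg_transp i j \in hyperoct n.
Proof. by rewrite !groupM ?xi_hyperoct ?sym_perm_hyperoct. Qed.

Lemma xi_inj : injective (@xi n).
Proof.
move=> i j /(congr1 (fun s : {perm signed n} => (s (false, i)).1)).
by rewrite !xiE /= eqxx => /esym/eqP.
Qed.

Lemma xi_neq1 (i : 'I_n) : (xi i == 1%g) = false.
Proof.
apply/negP=> /eqP/(congr1 (fun s : {perm signed n} => (s (false, i)).1)).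
by rewrite xiE perm1 /= eqxx.
Qed.

Let snd_neq (i j : 'I_n) (s t : {perm signed n}) : (i < j)%N ->
  (s (false, i)).2 = j -> (t (false, i)).2 = i -> (s == t) = false.
Proof.
move=> ij si ti; apply/negP=> /eqP st; move: ij.
by rewrite -{1}ti -st si ltnn.
Qed.

Let fst_neq (k : 'I_n) (s t : {perm signed n}) :
  (s (false, k)).1 -> ~~ (t (false, k)).1 -> (s == t) = false.
Proof. by move=> sk tk; apply/negP=> /eqP st; move: sk; rewrite st (negbTE tk). Qed.

Let snd_inj (i j i' j' : 'I_n) : (i < j)%N -> (i' < j')%N ->
  (forall k, tperm i j k = tperm i' j' k) -> (i = i') /\ (j = j').
Proof.
move=> ij ij' e; have := e i; have := e j; rewrite tpermL tpermR.
case: tpermP => [F|F|_ _] E; case: tpermP => [F'|F'|_ _] E'; move: ij ij';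
  rewrite ?E ?E' ?F ?F' ?ltnn // => ij ij'; subst; rewrite ?ltnn in ij ij' *;
  by [split | have := ltn_trans ij ij'; rewrite ltnn].
Qed.

Let ltn_neq (i j : 'I_n) : (i < j)%N -> i != j.
Proof. by move=> ij; rewrite neq_ltn ij. Qed.

Let transp_eq (i j i' j' : 'I_n) : (i < j)%N -> (i' < j')%N ->
  (transp i j == transp i' j') = (i == i') && (j == j').
Proof.
move=> ij ij'; apply/eqP/andP=> [E|[/eqP-> /eqP->]//].
have [] := snd_inj ij ij'; last by move=> -> ->.
by move=> k; have := congr1 (fun s : {perm signed n} => (s (false, k)).2) E;
  rewrite !transpE.
Qed.

Let neg_transp_eq (i j i' j' : 'I_n) : (i < j)%N -> (i' < j')%N ->
  (neg_transp i j == neg_transp i' j') = (i == i') && (j == j').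
Proof.
move=> ij ij'; apply/eqP/andP=> [E|[/eqP-> /eqP->]//].
have [] := snd_inj ij ij'; last by move=> -> ->.
by move=> k; have := congr1 (fun s : {perm signed n} => (s (false, k)).2) E;
  rewrite !neg_transpE ?ltn_neq.
Qed.

Let neg_transp_transp (i j i' j' : 'I_n) : (i < j)%N ->
  (neg_transp i j == transp i' j') = false.
Proof.
move=> ij; apply: (@fst_neq i); rewrite ?transpE // neg_transpE ?ltn_neq //=.
by rewrite eqxx.
Qed.

Let transp_xi (i j k : 'I_n) : (i < j)%N -> (transp i j == xi k) = false.
Proof. by move=> ij; apply: (snd_neq ij); rewrite ?transpE ?xiE //= tpermL. Qed.

Let neg_transp_xi (i j k : 'I_n) : (i < j)%N -> (neg_transp i j == xi k) = false.
Proof.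
move=> ij; apply: (snd_neq ij); rewrite ?neg_transpE ?ltn_neq ?xiE //=.
by rewrite tpermL.
Qed.

Let transp1 (i j : 'I_n) : (i < j)%N -> (transp i j == 1%g) = false.
Proof. by move=> ij; apply: (snd_neq ij); rewrite ?transpE ?perm1 //= tpermL. Qed.

Let neg_transp1 (i j : 'I_n) : (i < j)%N -> (neg_transp i j == 1%g) = false.
Proof.
move=> ij; apply: (snd_neq ij); rewrite ?neg_transpE ?ltn_neq ?perm1 //=.
by rewrite tpermL.
Qed.

Let sum_pair (f : 'I_n -> R) (c : 'I_n -> 'I_n -> R) (i j : 'I_n) :
    (i < j)%N ->
    (forall i' j' : 'I_n, (i' < j')%N -> c i' j' = ((i == i') && (j == j'))%:R) ->
  \sum_(j' < n) \sum_(i' < n | (i' < j')%N) c i' j' * f j' = f j.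
Proof.
move=> ij cE; rewrite (bigD1 j) //= (bigD1 i) //= cE // !eqxx mul1r.
rewrite !big1 ?addr0 // => [j' nej|i' /andP[ij' nei]]; last first.
  by rewrite cE // eq_sym (negbTE nei) mul0r.
by apply: big1 => i' ij'; rewrite cE // (eq_sym j) (negbTE nej) andbF mul0r.
Qed.

Lemma ost1 : ost 1%g = (2 * total_weight)^-1 * \sum_(j < n) w j.+1 / j.+1%:R.
Proof.
rewrite /ost eqxx mul1r [X in _ + X + _]big1 ?[X in _ + X]big1 ?addr0 //.
  move=> j _; apply: big1 => i ij.
  by rewrite ![1%g == _]eq_sym transp1 ?neg_transp1 // addr0 mul0r.
by move=> j _; rewrite eq_sym xi_neq1 mul0r.
Qed.

Lemma ost_xi (j : 'I_n) : ost (xi j) = ost_rate j.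
Proof.
rewrite /ost xi_neq1 mul0r add0r (bigD1 j) //= eqxx mul1r.
rewrite [X in _ + X + _]big1 ?[X in _ + X]big1 ?addr0 //.
  move=> k _; apply: big1 => i ik.
  by rewrite ![xi j == _]eq_sym transp_xi ?neg_transp_xi // addr0 mul0r.
by move=> k nek; rewrite (inj_eq xi_inj) eq_sym (negbTE nek) mul0r.
Qed.

Lemma ost_transp (i j : 'I_n) : (i < j)%N -> ost (transp i j) = ost_rate j.
Proof.
move=> ij; rewrite /ost transp1 // mul0r add0r big1 ?add0r; last first.
  by move=> k _; rewrite transp_xi // mul0r.
apply: (sum_pair _ ij) => i' j' ij'.
by rewrite transp_eq // [transp i j == _]eq_sym neg_transp_transp // addr0.
Qed.

Lemma ost_neg_transp (i j : 'I_n) :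
  (i < j)%N -> ost (neg_transp i j) = ost_rate j.
Proof.
move=> ij; rewrite /ost neg_transp1 // mul0r add0r big1 ?add0r; last first.
  by move=> k _; rewrite neg_transp_xi // mul0r.
apply: (sum_pair _ ij) => i' j' ij'.
by rewrite neg_transp_eq // neg_transp_transp // add0r.
Qed.

Lemma ost_out (g : {perm signed n}) :
    g != 1%g -> (forall j, g != xi j) ->
    (forall i j : 'I_n, (i < j)%N -> g != transp i j /\ g != neg_transp i j) ->
  ost g = 0.
Proof.
move=> g1 gx gt; rewrite /ost (negbTE g1) mul0r !big1 ?addr0 // => j _.
  by apply: big1 => i /gt [/negbTE-> /negbTE->]; rewrite addr0 mul0r.
by rewrite (negbTE (gx j)) mul0r.
Qed.

End Shuffle.

(* A partition of m <= n, as the sequence of its row lengths padded with zeros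
   to length n. *)
Definition row_lengths (n : nat) : finType := {ffun 'I_n -> 'I_n.+1}.

Definition is_partition n (mu : row_lengths n) : bool :=
  [forall i : 'I_n, forall j : 'I_n, (i <= j)%N ==> (mu j <= mu i)%N].

Definition bipartitions (n : nat) : {set row_lengths n * row_lengths n} :=
  [set la | [&& is_partition la.1, is_partition la.2 &
             (\sum_i la.1 i + \sum_i la.2 i)%N == n]].

(* The boxes (i, j) of the Young diagram of mu, numbered from 0. *)
Definition boxes n (mu : row_lengths n) : finType :=
  {b : 'I_n * 'I_n | (b.2 < mu b.1)%N}.

Definition box_row n (mu : row_lengths n) (b : boxes mu) : nat := (val b).1.+1.
Definition box_col n (mu : row_lengths n) (b : boxes mu) : nat := (val b).2.+1.

(* A filling of a pair of diagrams; the value k : 'I_n stands for the entry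
   k + 1. *)
Definition filling n (la : row_lengths n * row_lengths n) : finType :=
  {ffun boxes la.1 + boxes la.2 -> 'I_n}.

Definition increasing n (mu : row_lengths n) (t : boxes mu -> 'I_n) : bool :=
  [forall b, forall c,
    ((box_row b == box_row c) && (box_col b < box_col c)%N ==> (t b < t c)%N) &&
    ((box_col b == box_col c) && (box_row b < box_row c)%N ==> (t b < t c)%N)].

Definition tab1 n (la : row_lengths n * row_lengths n) (T : filling la)
  (b : boxes la.1) : 'I_n := T (inl b).
Definition tab2 n (la : row_lengths n * row_lengths n) (T : filling la)
  (b : boxes la.2) : 'I_n := T (inr b).

Definition SYT n (la : row_lengths n * row_lengths n) : {set filling la} :=
  [set T : filling la |
    [&& [forall k : 'I_n, #|[set b | T b == k]| == 1%N],
        increasing (tab1 T) & increasing (tab2 T)]].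

Definition eig (R : realFieldType) (w : nat -> R) n
    (la : row_lengths n * row_lengths n) (T : filling la) : R :=
  (total_weight w n)^-1 *
    (\sum_(b : boxes la.1)
        ((box_col b)%:R - (box_row b)%:R + 1) / (tab1 T b).+1%:R * w (tab1 T b).+1 +
     \sum_(b : boxes la.2)
        ((box_col b)%:R - (box_row b)%:R) / (tab2 T b).+1%:R * w (tab2 T b).+1).

(* Main.v *)
From HB Require Import structures.
Require Import Defs.
From mathcomp Require Import all_boot all_order all_algebra all_fingroup.
From mathcomp Require Import ring zify.

(* The shuffle is a combination of the commuting elements
     p_j = (1 + xi_j) / 2   and   y_j = 1/2 sum_(i < j) ((i j) + xi_i xi_j (i j))
   (halved Jucys-Murphy elements) of the group algebra of B_n.  Instead of
   constructing representations, one computes the joint distribution of the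
   [p_j] and [y_j] under the trace [a |-> a 1], one index at a time: the
   conditional expectation on B_j of [p_j * y_j ^+ m] is a polynomial in the
   earlier elements, because the relation [s y_(j+1) = y_j s + ...] makes the
   conditional moments satisfy a linear recurrence.  The transition measure of
   a growing partition, written with Frobenius' product formula, satisfies the
   same recurrence (Lagrange interpolation provides its first two moments), so
   the trace is the average over random standard bitableaux of their content
   vectors, with weights d_lambda / |B_n|.  Hence the traces of the powers of
   the transition matrix are the power sums of the expected spectrum; as the
   matrix is symmetric, this determines its characteristic polynomial. *)

Set Implicit Arguments.
Unset Strict Implicit.
Unset Printing Implicit Defensive.

Import Order.TTheory GRing.Theory Num.Theory.
Local Open Scope ring_scope.

(** In generating series in 1/z the two recurrences have the same form. Adding a box of content x to
    a diagram multiplies the moment series of its transition measure by (z - x)^2 / ((z - x)^2 - 1).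
    In the algebra, comparing s x^k s with the powers of the next halved Jucys-Murphy element gives
    the same factor up to initial terms, except that -1 becomes -p, where p projects on the sign of
    the earlier index: a box of one diagram does not affect the other diagram. With denominators
    cleared, both are recurrences of order two, which leave the moments of order 0 and 1 free; these
    are computed separately on both sides and equal 1/2 and 0, the 1/2 being the chance of either
    diagram. The number of rows is fixed to [n]. As long as a box remains to be added, the last row
    is empty, so some shifted row length is 0; this cancels the prefactor of [rho] and makes
    interpolation applicable. *)

(** * Spectrum of a symmetric matrix from the traces of its powers *)

Lemma char_poly_conj (F : fieldType) m (P A B : 'M[F]_m) :
  P \in unitmx -> P *m A = B *m P -> char_poly A = char_poly B.
Proof.
move=> Pu PAB; pose P' := map_mx (@polyC F) P.
have P'u : \det P' != 0.
  by rewrite det_map_mx polyC_eq0 -unitfE -unitmxE.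
have: P' *m char_poly_mx A = char_poly_mx B *m P'.
  by rewrite mulmxBr mulmxBl -!map_mxM PAB scalar_mxC.
by move=> /(congr1 (@determinant _ _)); rewrite !det_mulmx mulrC => /(mulIf P'u).
Qed.

Lemma horner_power_sums (F : fieldType) (s t : seq F) (p : {poly F}) :
  (forall k, \sum_(a <- s) a ^+ k = \sum_(a <- t) a ^+ k) ->
  \sum_(a <- s) p.[a] = \sum_(a <- t) p.[a].
Proof.
move=> st; under eq_bigr do rewrite horner_coef.
under [RHS]eq_bigr do rewrite horner_coef.
rewrite exchange_big [RHS]exchange_big; apply: eq_bigr => k _.
by rewrite -!mulr_sumr st.
Qed.

(** A polynomial vanishing at every value but [a] turns equal power sums into equal multiples of
    [p.[a]]; the multiplicities agree because natural numbers embed in [F]. *)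
Lemma perm_eq_power_sums (F : numFieldType) (s t : seq F) :
  (forall k, \sum_(a <- s) a ^+ k = \sum_(a <- t) a ^+ k) -> perm_eq s t.
Proof.
move=> st; apply/allP => a _ /=; apply/eqP.
pose p := \prod_(b <- undup (s ++ t) | b != a) ('X - b%:P).
have pa : p.[a] != 0.
  rewrite horner_prod prodf_seq_neq0; apply/allP => b _.
  by apply/implyP; rewrite hornerXsubC subr_eq0 eq_sym.
have pN b : b \in s ++ t -> b != a -> p.[b] = 0.
  move=> bst ba; rewrite horner_prod; apply/eqP; rewrite prodf_seq_eq0.
  by apply/hasP; exists b; rewrite ?mem_undup //= ba hornerXsubC subrr eqxx.
have sumE r : {subset r <= s ++ t} ->
    \sum_(b <- r) p.[b] = (count_mem a r)%:R * p.[a].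
  move=> rst; rewrite (bigID (pred1 a)) /= [X in _ + X]big1_seq ?addr0.
    rewrite (eq_bigr (fun=> p.[a])) => [|b /eqP-> //].
    by rewrite big_const_seq iter_addr_0 mulr_natl.
  by move=> b /andP[ba /rst /pN->].
have := horner_power_sums p st.
rewrite !sumE => [/(mulIf pa)/eqP|b bt|b bs]; last 2 first.
- by rewrite mem_cat bt orbT.
- by rewrite mem_cat bs.
by rewrite eqr_nat => /eqP.
Qed.

(** For symmetric [A] this trace is the sum of the squares of all entries. *)
Lemma symmetric_trace_sqr_eq0 (R : realDomainType) m (A : 'M[R]_m) :
  A^T = A -> \tr (A *m A) = 0 -> A = 0.
Proof.
move=> As; rewrite /mxtrace => /eqP; rewrite psumr_eq0 => [/allP/= trA|i _].
  apply/matrixP => i j; have := trA i (mem_index_enum i).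
  rewrite !mxE psumr_eq0 => [/allP/(_ j (mem_index_enum j))/=|k _].
    by rewrite -{1}As mxE -expr2 sqrf_eq0 -{1}As mxE => /eqP.
  by rewrite -{1}As mxE -expr2 sqr_ge0.
by rewrite mxE sumr_ge0 // => k _; rewrite -{1}As mxE -expr2 sqr_ge0.
Qed.

(* The polynomial vanishing exactly on [s] has square of trace zero at [A], so
   it kills the symmetric matrix [A]: no real closure is needed to diagonalize
   it. *)
Lemma char_poly_power_traces (R : realFieldType) m (A : 'M[R]_m) (s : seq R) :
    A^T = A -> (forall k, \tr (A ^+ k) = \sum_(a <- s) a ^+ k) ->
  char_poly A = \prod_(a <- s) ('X - a%:P).
Proof.
case: m A => [|m] A As trA.
  have := trA 0; rewrite big_const_seq count_predT iter_addr_0 expr0 => /eqP.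
  rewrite mxtrace1 eqr_nat => /eqP/esym/size0nil->.
  by rewrite big_nil /char_poly det_mx00.
pose p := \prod_(a <- undup s) ('X - a%:P).
have trE (q : {poly R}) : \tr (horner_mx A q) = \sum_(a <- s) q.[a].
  rewrite -[in LHS](coefK q) poly_def !linear_sum /=.
  under [RHS]eq_bigr do rewrite horner_coef; rewrite [RHS]exchange_big /=.
  apply: eq_bigr => i _; rewrite horner_mxZ rmorphXn /= horner_mx_X linearZ /=.
  by rewrite trA -mulr_sumr.
have pA : horner_mx A p = 0.
  apply: symmetric_trace_sqr_eq0.
    have : forall q, (horner_mx A q)^T = horner_mx A q.
      elim/poly_ind => [|q c IH]; first by rewrite rmorph0 trmx0.
      rewrite rmorphD rmorphM /= horner_mx_X horner_mx_C linearD /= tr_scalar_mx.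
      by rewrite trmx_mul IH As; congr (_ + _); apply: comm_mx_horner.
    exact.
  rewrite -[_ *m _]/(_ * _) -rmorphM /= trE big1_seq // => a /andP[_ sa].
  rewrite hornerM horner_prod (big_rem a) ?mem_undup //= hornerXsubC subrr.
  by rewrite !mul0r.
(* [p] kills [A] and has simple roots, so the minimal polynomial splits into distinct linear
   factors. *)
have : diagonalizable A.
  by apply/diagonalizableP; exists (undup s); rewrite ?undup_uniq ?mxminpoly_min.
case=> P Pu /diagonalizable_forPex[d /(simmxP Pu) PA].
have trAk k : \tr (A ^+ k) = \sum_i d 0 i ^+ k.
  have PAk : P *m A ^+ k = diag_mx d ^+ k *m P.
    elim: k => [|k IH]; first by rewrite !expr0 mulmx1 mul1mx.
    by rewrite !exprS mulmxA PA -mulmxA IH mulmxA.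
  have -> : A ^+ k = invmx P *m (diag_mx d ^+ k *m P) by rewrite -PAk mulKmx.
  rewrite mxtrace_mulC -mulmxA mulmxV // mulmx1.
  suff -> : diag_mx d ^+ k = diag_mx (map_mx (fun x => x ^+ k) d).
    by rewrite mxtrace_diag; apply: eq_bigr => i _; rewrite mxE.
  elim: k {PAk} => [|k IH].
    rewrite expr0 -[1]/(1%:M) -diag_const_mx; congr diag_mx.
    by apply/rowP => i; rewrite !mxE.
  rewrite exprS IH -[_ * _]/(_ *m _) mulmx_diag; congr diag_mx; apply/rowP => i.
  by rewrite !mxE exprS.
rewrite (char_poly_conj Pu PA) char_poly_trig ?diag_mx_is_trig //.
have /perm_eq_power_sums E k : \sum_(a <- [seq d 0 i | i : 'I_m.+1]) a ^+ k =
    \sum_(a <- s) a ^+ k.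
  by rewrite big_map -trA trAk enumT.
rewrite -(perm_big _ E) /= big_map enumT; apply: eq_bigr => i _.
by rewrite !mxE eqxx.
Qed.

(** * Lagrange interpolation and coefficients of products of linear factors *)

Lemma big_prod_XsubC (F : fieldType) n (P : pred 'I_n) (a : 'I_n -> F) :
  \prod_(j | P j) ('X - (a j)%:P) =
  \prod_(x <- [seq a j | j <- enum P]) ('X - x%:P).
Proof. by rewrite big_map big_enum. Qed.

(** [f] equals its interpolant at the [n] nodes, a combination of the [L r], which are monic of
    degree [n - 1]; the coefficients of that degree are compared. *)
Lemma lagrange_lead_coef (F : fieldType) n (a : 'I_n -> F) (f : {poly F}) :
    injective a -> (size f <= n)%N ->
  \sum_r f.[a r] / (\prod_(j | j != r) (a r - a j)) = f`_n.-1.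
Proof.
move=> ia szf; pose L r := \prod_(j | j != r) ('X - (a j)%:P).
have LE r : L r = \prod_(x <- [seq a j | j <- enum (predC1 r)]) ('X - x%:P).
  exact: big_prod_XsubC.
have szL r : size (L r) = n.
  rewrite LE size_prod_XsubC size_map -cardE cardC1 card_ord.
  by case: n r {a f ia szf L LE} => // -[].
have L1 r : (L r)`_n.-1 = 1.
  by rewrite -[in _.-1](szL r) -lead_coefE LE; apply/monicP/monic_prod_XsubC.
have Lr r : (L r).[a r] = \prod_(j | j != r) (a r - a j).
  by rewrite horner_prod; apply: eq_bigr => j _; rewrite hornerXsubC.
have Ls r s : s != r -> (L r).[a s] = 0.
  by move=> sr; rewrite horner_prod (bigD1 s) //= hornerXsubC subrr mul0r.
have nz r : \prod_(j | j != r) (a r - a j) != 0.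
  apply/prodf_neq0 => j jr.
  by rewrite subr_eq0 (inj_eq ia) eq_sym.
pose g := \sum_r (f.[a r] / (\prod_(j | j != r) (a r - a j))) *: L r.
suff fg : f = g.
  rewrite [in RHS]fg coef_sum; apply: eq_bigr => r _.
  by rewrite coefZ L1 mulr1.
apply/eqP; rewrite -subr_eq0; apply/eqP.
apply: (@roots_geq_poly_eq0 _ _ [seq a j | j <- enum 'I_n]).
- apply/allP => _ /mapP[r _ ->]; rewrite /root hornerD hornerN subr_eq0.
  rewrite horner_sum (bigD1 r) //= hornerZ Lr divfK // big1 ?addr0 // => s sr.
  by rewrite hornerZ Ls 1?eq_sym // mulr0.
- by rewrite map_inj_uniq ?enum_uniq.
rewrite size_map size_enum_ord (leq_trans (size_polyD _ _)) // geq_max szf.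
rewrite size_polyN; apply: (leq_trans (size_sum _ _ _)).
by apply/bigmax_leqP => r _; rewrite (leq_trans (size_scale_leq _ _)) ?szL.
Qed.

Section ProdXsubC.
Variables (F : fieldType) (n : nat).
Implicit Types b : 'I_n -> F.

Let prodX b : {poly F} := \prod_j ('X - (b j)%:P).

Let prodXE b : prodX b = \prod_(x <- [seq b j | j <- enum 'I_n]) ('X - x%:P).
Proof. exact: big_prod_XsubC. Qed.

Let size_s b : size [seq b j | j <- enum 'I_n] = n.
Proof. by rewrite size_map size_enum_ord. Qed.

Lemma size_prodXsubC_ord b : size (\prod_j ('X - (b j)%:P)) = n.+1.
Proof. by rewrite -/(prodX b) prodXE size_prod_XsubC size_s. Qed.

Lemma coefn_prodXsubC_ord b : (\prod_j ('X - (b j)%:P))`_n = 1.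
Proof.
have /monicP := monic_prod_XsubC [seq b j | j <- enum 'I_n] xpredT id.
by rewrite lead_coefE -prodXE size_prodXsubC_ord.
Qed.

Lemma coefPn_prodXsubC_ord b :
  (0 < n)%N -> (\prod_j ('X - (b j)%:P))`_n.-1 = - \sum_j b j.
Proof.
move=> n0; rewrite -/(prodX b) prodXE -[in _.-1](size_s b).
by rewrite coefPn_prod_XsubC ?size_s -?lt0n // big_map big_enum.
Qed.

(** Both sides are twice the second elementary symmetric function, by Newton's identity; the factor
    ['X] shifts the index so that the formula stays true for [n < 2]. *)
Lemma coefPPn_prodXsubC_ord b :
  ('X * \prod_j ('X - (b j)%:P))`_n.-1 *+ 2 =
  (\sum_j b j) ^+ 2 - \sum_j b j ^+ 2.
Proof.
have -> : \sum_j b j = \sum_(x <- [seq b j | j <- enum 'I_n]) x.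
  by rewrite big_map big_enum.
have -> : \sum_j b j ^+ 2 = \sum_(x <- [seq b j | j <- enum 'I_n]) x ^+ 2.
  by rewrite big_map big_enum.
rewrite -/(prodX b) prodXE -[in _.-1](size_s b).
elim: [seq _ | _ <- _] => [|x s IH].
  by rewrite !big_nil coefXM mul0rn expr0n subrr.
rewrite !big_cons /= mulrCA mulrBl coefB coefCM mulrnBl.
have -> : ('X * ('X * \prod_(j <- s) ('X - j%:P)))`_(size s) =
    ('X * \prod_(j <- s) ('X - j%:P))`_(size s).-1.
  by rewrite coefXM; case: (size s) => //=; rewrite coefXM.
have -> : ('X * \prod_(j <- s) ('X - j%:P))`_(size s) = - \sum_(j <- s) j.
  rewrite coefXM; case: s {IH} => [|y s] /=; first by rewrite big_nil oppr0.
  by rewrite -[size s]/(size (y :: s)).-1 coefPn_prod_XsubC.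
by rewrite IH; ring.
Qed.

End ProdXsubC.

(** * Sum rules for the transition measure of a growing partition *)

(* If [l] lists the shifted row lengths of a partition lambda of m, then [rho]
   is d_(lambda + box in row r) / ((m + 1) d_lambda) by Frobenius' formula; it
   vanishes when no box can be added in that row. *)
Definition rho (R : numFieldType) n (l : 'I_n -> nat) (r : 'I_n) : R :=
  (l r).+1%:R^-1 *
    \prod_(j | j != r) (((l r).+1%:R - (l j)%:R) / ((l r)%:R - (l j)%:R)).

Section Rho.
Variables (R : numFieldType) (n : nat) (l : 'I_n -> nat).
Hypothesis l_inj : injective l.

Let a (j : 'I_n) : R := (l j)%:R.

Let a_inj : injective a.
Proof. by move=> i j /eqP; rewrite eqr_nat => /eqP /l_inj. Qed.

Let nz r : \prod_(j | j != r) (a r - a j) != 0.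
Proof. by apply/prodf_neq0 => j jr; rewrite subr_eq0 (inj_eq a_inj) eq_sym. Qed.

(** In the full product the factor of [i0] is [(l r).+1] and that of [r] is 1. The prefactor of
    [rho] is thereby absorbed, and its numerator becomes a polynomial of degree [n - 1] in [a r]. *)
Let shift_prod (i0 r : 'I_n) : l i0 = 0%N ->
  \prod_(j | j != i0) (a r + 1 - a j) =
  (l r).+1%:R^-1 * \prod_(j | j != r) (a r + 1 - a j).
Proof.
move=> l0; apply: (@mulfI _ (l r).+1%:R); first by rewrite pnatr_eq0.
rewrite mulrA divff ?pnatr_eq0 // mul1r.
have := erefl (\prod_j (a r + 1 - a j)).
rewrite {1}(bigD1 i0) // [in RHS](bigD1 r) //= /a l0 subr0 natr1 => ->.
by rewrite -natr1 addrAC subrr add0r mul1r.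
Qed.

Let rhoE r : rho R l r =
  (l r).+1%:R^-1 * (\prod_(j | j != r) (a r + 1 - a j)) /
  \prod_(j | j != r) (a r - a j).
Proof. by rewrite /rho -natr1 prodf_div mulrA. Qed.

(** Interpolation returns the leading coefficient of the monic numerator. For tableaux: the numbers
    d of all partitions obtained by adding a box to lambda, of size m, sum to (m + 1) d_lambda. *)
Lemma sum_rho i0 : l i0 = 0%N -> \sum_r rho R l r = 1.
Proof.
move=> l0; pose f := \prod_(j | j != i0) ('X - (a j - 1)%:P).
have fE : f = \prod_(x <- [seq a j - 1 | j <- enum (predC1 i0)]) ('X - x%:P).
  exact: big_prod_XsubC.
have szf : size f = n.
  rewrite fE size_prod_XsubC size_map -cardE cardC1 card_ord.
  by rewrite prednK // (leq_ltn_trans _ (ltn_ord i0)).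
have f1 : f`_n.-1 = 1.
  by rewrite -[in _.-1]szf -lead_coefE fE; apply/monicP/monic_prod_XsubC.
rewrite -f1 -(lagrange_lead_coef a_inj) ?szf //; apply: eq_bigr => r _.
rewrite rhoE -(shift_prod _ l0) /f horner_prod; congr (_ / _).
by apply: eq_bigr => j _; rewrite hornerXsubC opprB addrA addrAC.
Qed.

Lemma sum_rho_mul i0 : l i0 = 0%N -> \sum_r rho R l r * (l r)%:R = n.-1%:R.
Proof.
move=> l0; have n0 : (0 < n)%N := leq_ltn_trans (leq0n _) (ltn_ord i0).
pose b j := if j == i0 then 0 else a j - 1.
(* The second product vanishes at all nodes and cancels the top coefficient of the first, bringing
   the degree below [n]. *)
pose f := \prod_j ('X - (b j)%:P) - \prod_j ('X - (a j)%:P).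
have fE r : f.[a r] = (l r)%:R * \prod_(j | j != i0) (a r + 1 - a j).
  rewrite /f hornerD hornerN !horner_prod [X in _ - X](bigD1 r) //=.
  rewrite hornerXsubC subrr mul0r subr0 (bigD1 i0) //= hornerXsubC /b eqxx subr0.
  congr (_ * _); apply: eq_bigr => j /negbTE->.
  by rewrite hornerXsubC opprB addrA addrAC.
have szf : (size f <= n)%N.
  apply/leq_sizeP => j; rewrite leq_eqVlt => /predU1P[<-|nj].
    by rewrite coefB !coefn_prodXsubC_ord subrr.
  by rewrite coefB !nth_default ?subrr ?size_prodXsubC_ord.
rewrite (eq_bigr (fun r => f.[a r] / \prod_(j | j != r) (a r - a j))); last first.
  by move=> r _; rewrite rhoE -(shift_prod _ l0) fE mulrAC [X in X / _]mulrC.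
rewrite (lagrange_lead_coef a_inj szf) coefB !coefPn_prodXsubC_ord //.
rewrite opprK (bigD1 i0) //= /b eqxx add0r [X in _ + X](bigD1 i0) //= {2}/a l0 add0r.
rewrite (eq_bigr (fun j => a j - 1)) => [|j /negbTE-> //].
by rewrite sumrB opprB subrK sumr_const cardC1 card_ord.
Qed.

(** For shifted row lengths the right-hand side is the number m of boxes, and each nonzero summand
    is m d_mu / d_lambda with mu obtained by removing a box: this is the branching rule for
    d_lambda. *)
Lemma sum_removals :
  \sum_r a r * \prod_(j | j != r) ((a r - 1 - a j) / (a r - a j)) =
  \sum_r a r - ('C(n, 2))%:R.
Proof.
have [n_eq0|n0] := posnP n.
  have nord (r : 'I_n) : False by have := ltn_ord r; rewrite [X in (_ < X)%N]n_eq0.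
  by rewrite !big1 => [|r|r]; rewrite ?[X in 'C(X, _)]n_eq0 ?subrr //; case: (nord r).
pose P (b : 'I_n -> R) : {poly R} := \prod_j ('X - (b j)%:P).
(* At a node only the shifted product survives; [n%:R *: P a] vanishes there and cancels the term of
   degree [n]. *)
pose f := 'X * (P a - P (fun j => a j + 1)) - n%:R *: P a.
have fE r : f.[a r] = a r * \prod_(j | j != r) (a r - 1 - a j).
  rewrite /f hornerD hornerN hornerZ hornerM hornerX hornerD hornerN.
  rewrite !horner_prod (bigD1 r) //= hornerXsubC subrr mul0r mulr0 subr0 add0r.
  rewrite (bigD1 r) //= hornerXsubC opprD addrA subrr add0r mulN1r opprK.
  by congr (_ * _); apply: eq_bigr => j _; rewrite hornerXsubC opprD addrA addrAC.
have szf : (size f <= n)%N.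
  apply/leq_sizeP => -[|j]; first by rewrite leqNgt n0.
  rewrite coefB coefXM coefZ /= coefB leq_eqVlt => /predU1P[nj|nj].
    rewrite -[in X in _ * X]nj coefn_prodXsubC_ord mulr1 -[j]/(j.+1.-1) -nj.
    by rewrite !coefPn_prodXsubC_ord // big_split /= sumr_const card_ord; ring.
  rewrite [X in _ * X]nth_default ?size_prodXsubC_ord //.
  move: nj; rewrite ltnS leq_eqVlt => /predU1P[<-|nj].
    by rewrite !coefn_prodXsubC_ord subrr mulr0 subrr.
  by rewrite !nth_default ?size_prodXsubC_ord // subrr mulr0 subrr.
rewrite (eq_bigr (fun r => f.[a r] / \prod_(j | j != r) (a r - a j))); last first.
  by move=> r _; rewrite fE prodf_div mulrA.
rewrite (lagrange_lead_coef a_inj szf) coefB coefZ coefPn_prodXsubC_ord //.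
rewrite mulrBr coefB.
have Ta := coefPPn_prodXsubC_ord a.
have Tb := coefPPn_prodXsubC_ord (fun j => a j + 1).
move: Ta Tb; set Ta := _`_n.-1; set Tb := _`_n.-1 => TaE TbE.
have sq : \sum_j (a j + 1) ^+ 2 = \sum_j a j ^+ 2 + (\sum_j a j) *+ 2 + n%:R.
  rewrite -sumrMnl -[X in _ + X%:R]card_ord -sumr_const -!big_split.
  by apply: eq_bigr => j _ /=; ring.
rewrite sq big_split /= sumr_const card_ord in TbE.
have C2 : ('C(n, 2))%:R * 2 = n%:R * (n%:R - 1) :> R.
  rewrite -natrM -[2%N]/(2`!)%N bin_ffact ffactnSr ffactn1 natrM.
  by rewrite natrB.
apply: (@mulIf _ 2%:R); first by rewrite pnatr_eq0.
rewrite [RHS]mulrBl C2.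
have -> : (Ta - Tb - n%:R * - (\sum_j a j)) * 2%:R =
  Ta *+ 2 - Tb *+ 2 + n%:R * (\sum_j a j) *+ 2 by ring.
by rewrite TaE TbE; ring.
Qed.
End Rho.

(** * Effect of one added box on Frobenius' product and on the moments *)

Definition incr n (l : 'I_n -> nat) (r i : 'I_n) : nat := (l i + (i == r))%N.

(* The counterpart of [rho] for removing a box from row [r]. *)
Definition sigma (R : numFieldType) n (l : 'I_n -> nat) (r : 'I_n) : R :=
  (l r)%:R * \prod_(j | j != r) (((l r)%:R - 1 - (l j)%:R) / ((l r)%:R - (l j)%:R)).

(* d_lambda / m!, up to a constant depending on [n] only. *)
Definition vdm (R : numFieldType) n (l : 'I_n -> nat) : R :=
  (\prod_(i < n) \prod_(j < n) (if (i < j)%N then (l i)%:R - (l j)%:R else 1)) /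
  \prod_i (l i)`!%:R.

(* The content of a box added in row [r], for shifted row lengths [l]. *)
Definition cont (R : numFieldType) n (l : 'I_n -> nat) (r : 'I_n) : R :=
  (l r)%:R - n.-1%:R.

Definition moment (R : numFieldType) n (l : 'I_n -> nat) k : R :=
  \sum_r rho R l r * cont R l r ^+ k.

Section Increment.
Variables (R : numFieldType) (n : nat).
Implicit Types (l : 'I_n -> nat) (r i : 'I_n).

Let natr_neq l r i : injective l -> i != r -> (l r)%:R - (l i)%:R != 0 :> R.
Proof. by move=> li ir; rewrite subr_eq0 eqr_nat (inj_eq li) eq_sym. Qed.

Lemma eq_rho l l' r : l =1 l' -> rho R l r = rho R l' r.
Proof.
move=> ll'; rewrite /rho !ll'; congr (_ * _).
by apply: eq_bigr => j _; rewrite !ll'.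
Qed.

Lemma eq_moment l l' k : l =1 l' -> moment R l k = moment R l' k.
Proof.
by move=> ll'; apply: eq_bigr => r _; rewrite (eq_rho r ll') /cont ll'.
Qed.

Lemma eq_vdm l l' : l =1 l' -> vdm R l = vdm R l'.
Proof.
move=> ll'; rewrite /vdm; congr (_ / _); last first.
  by apply: eq_bigr => i _; rewrite ll'.
by apply: eq_bigr => i _; apply: eq_bigr => j _; rewrite !ll'.
Qed.

Lemma vdm_neq0 l : injective l -> vdm R l != 0.
Proof.
move=> li; apply: mulf_neq0; last first.
  by rewrite invr_eq0; apply/prodf_neq0 => i _; rewrite pnatr_eq0 -lt0n fact_gt0.
apply/prodf_neq0 => i _; apply/prodf_neq0 => j _.
by case: ifP => [ij|_]; rewrite ?oner_eq0 // natr_neq // neq_ltn ij orbT.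
Qed.

Let diff l r := \prod_(j | j != r) ((l r)%:R - (l j)%:R : R).

(** [C] gathers the factors not involving row [r], with the sign that lets each remaining difference
    start with [l r]; it serves every [l'] that differs from [l] only there. *)
Let vdm_split l r : exists2 C : R,
    vdm R l = C * diff l r / (l r)`!%:R &
    forall l', (forall j, j != r -> l' j = l j) ->
      vdm R l' = C * diff l' r / (l' r)`!%:R.
Proof.
pose f l (i j : 'I_n) := if (i < j)%N then (l i)%:R - (l j)%:R else 1 : R.
pose C0 l := \prod_(i | i != r) \prod_(j | j != r) f l i j.
pose D l : R := \prod_(i | i != r) (l i)`!%:R.
pose s := \prod_(j | j != r) (if (r < j)%N then 1 else -1) : R.
have E l0 : vdm R l0 = C0 l0 * s / D l0 * diff l0 r / (l0 r)`!%:R.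
  rewrite /vdm [X in _ / X](bigD1 r) //= -/(D _).
  suff -> : \prod_i \prod_j f l0 i j = C0 l0 * (s * diff l0 r).
    by rewrite invfM !mulrA mulrAC [X in X / _]mulrAC.
  have f1 : f l0 r r = 1 by rewrite /f ltnn.
  rewrite (bigD1 r) //= [X in X * _](bigD1 r) //= f1 mul1r.
  rewrite [X in _ * X](eq_bigr
    (fun i => f l0 i r * \prod_(j | j != r) f l0 i j)); last first.
    by move=> i _; rewrite (bigD1 r).
  rewrite big_split /= mulrA mulrC; congr (_ * _); rewrite /s /diff -!big_split.
  apply: eq_bigr => j jr; rewrite /f /=; have := neq_ltn j r; rewrite jr.
  by case: ltngtP => //= _ _; rewrite ?mul1r ?mulr1 // mulN1r opprB.
exists (C0 l * s / D l) => // l' ll'; rewrite E; congr (_ * _ / _ * _ / _).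
  apply: eq_bigr => i ir; apply: eq_bigr => j jr; rewrite /f !ll' //.
by apply: eq_bigr => i ir; rewrite ll'.
Qed.

Lemma vdm_incr l r : injective l -> vdm R (incr l r) = rho R l r * vdm R l.
Proof.
move=> li; have [C -> CE] := vdm_split l r.
rewrite CE => [|j /negbTE jr]; last by rewrite /incr jr addn0.
rewrite /rho prodf_div -/(diff l r) /diff.
have lr : incr l r r = (l r).+1 by rewrite /incr eqxx addn1.
rewrite lr factS natrM (eq_bigr (fun j => (l r).+1%:R - (l j)%:R)); last first.
  by move=> j /negbTE jr; rewrite [in X in _ - X]/incr jr addn0.
have nz : \prod_(j | j != r) ((l r)%:R - (l j)%:R : R) != 0.
  by apply/prodf_neq0 => j; apply: natr_neq.
have f0 : (l r)`!%:R != 0 :> R by rewrite pnatr_eq0 -lt0n fact_gt0.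
have r0 : (l r).+1%:R != 0 :> R by rewrite pnatr_eq0.
move: nz f0 r0; move: (\prod_(j | _) _) (_`!%:R) (_.+1%:R) => B f a nz f0 a0.
by field; rewrite nz f0 a0.
Qed.

Lemma sigma_incr l r : injective l -> injective (incr l r) ->
  sigma R (incr l r) r * vdm R (incr l r) = vdm R l.
Proof.
move=> li li'; rewrite vdm_incr // mulrA.
suff -> : sigma R (incr l r) r * rho R l r = 1 by rewrite mul1r.
have lr : incr l r r = (l r).+1 by rewrite /incr eqxx addn1.
rewrite /sigma /rho lr mulrACA divff ?pnatr_eq0 // mul1r -big_split big1 // => j jr.
have lj : incr l r j = l j by rewrite /incr (negbTE jr) addn0.
have /= := natr_neq li' jr; rewrite lr lj => n1; have /= n2 := natr_neq li jr.
by rewrite -[X in X - 1]natr1 addrK mulrA divfK // divff.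
Qed.

(** Only the factor of this pair of rows changes: with d the difference of the old shifted lengths,
    [rho] is multiplied by d^2 / (d^2 - 1). Without denominators the identity also covers d = 0 and
    d = -1. *)
Lemma rho_incr l r i : injective (incr l i) -> r != i ->
  rho R (incr l i) r * (((incr l i r)%:R - (incr l i i)%:R + 1) ^+ 2 - 1) =
  rho R l r * ((incr l i r)%:R - (incr l i i)%:R + 1) ^+ 2.
Proof.
move=> li ri; have lr : incr l i r = l r by rewrite /incr (negbTE ri) addn0.
have lii : incr l i i = (l i).+1 by rewrite /incr eqxx addn1.
have := natr_neq li; move=> /(_ r i); rewrite eq_sym ri lr lii => /(_ isT) n1.
rewrite /rho lr (bigD1 i) 1?eq_sym //= [in RHS](bigD1 i) 1?eq_sym //= lii.
set P := \prod_(_ | _) _; set Q := \prod_(_ | _) _.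
have -> : P = Q by apply: eq_bigr => j /andP[_ /negbTE ji]; rewrite /incr ji addn0.
have r0 : (l r).+1%:R != 0 :> R by rewrite pnatr_eq0.
rewrite -!natr1 in n1 r0 *; move: n1 r0; move: (l r)%:R (l i)%:R => x y n1 r0.
have [<-|] := eqVneq x y; first by rewrite !subrr invr0; ring.
by rewrite -subr_eq0 => n2; field; rewrite n2 n1 r0.
Qed.

(** Termwise this is [rho_incr] with d = c - x, where c is the content of row [r]. Row [i] drops
    out: its new content x + 1 is a root of (c - x)^2 - 1, its old content x a root of (c - x)^2. *)
Lemma moment_rec l i k : injective (incr l i) -> let x := cont R l i in
  moment R (incr l i) k.+2 - 2 * x * moment R (incr l i) k.+1 +
    (x ^+ 2 - 1) * moment R (incr l i) k =
  moment R l k.+2 - 2 * x * moment R l k.+1 + x ^+ 2 * moment R l k.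
Proof.
move=> li x; rewrite /moment !mulr_sumr -!sumrB -!big_split /=.
apply: eq_bigr => r _.
have [->|ri] := eqVneq r i.
  have -> : cont R (incr l i) i = x + 1.
    by rewrite /x /cont /incr eqxx addn1 -natr1 addrAC.
  by rewrite -/x !exprS; ring.
have -> : cont R (incr l i) r = cont R l r.
  by rewrite /cont /incr (negbTE ri) addn0.
have := rho_incr li ri.
have -> : (incr l i r)%:R - (incr l i i)%:R + 1 = cont R l r - x.
  rewrite /x /cont /incr (negbTE ri) eqxx addn0 addn1 -natr1; ring.
set c := cont R l r => E.
transitivity (rho R (incr l i) r * ((c - x) ^+ 2 - 1) * c ^+ k).
  by rewrite !exprS; ring.
by rewrite E !exprS; ring.
Qed.

End Increment.

(** * Growth words of bipartitions and their number *)

Definition part n (la : 'I_n -> nat) : bool :=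
  [forall i : 'I_n, forall j : 'I_n, (i <= j)%N ==> (la j <= la i)%N].

(* Shifted row lengths: strictly decreasing when [la] is nonincreasing. *)
Definition beta n (la : 'I_n -> nat) (i : 'I_n) : nat := (la i + (n - i.+1))%N.

(* A standard bitableau is read as the word of the diagrams ([false] for the
   first one) and rows receiving 1, 2, and so on; the latest box is at the head
   of the word. *)
Notation step n := (bool * 'I_n)%type.

Definition rows n (u : seq (step n)) (e : bool) (i : 'I_n) : nat :=
  count_mem (e, i) u.

Definition addable n (u : seq (step n)) (st : step n) : bool :=
  part (rows (st :: u) st.1).

Fixpoint vwords n k : seq (seq (step n)) :=
  if k is k'.+1 then
    flatten [seq [seq st :: u | st <- enum (addable u)] | u <- vwords n k']
  else [:: [::]].

Section Words.
Variables (R : numFieldType) (n : nat).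
Implicit Types (u : seq (step n)) (e : bool) (r : 'I_n) (la : 'I_n -> nat).

Lemma partP la :
  reflect (forall i j : 'I_n, (i <= j)%N -> (la j <= la i)%N) (part la).
Proof.
apply: (iffP forallP) => [h i j ij|h i].
  by move/forallP/(_ j)/implyP: (h i); apply.
by apply/forallP => j; apply/implyP/h.
Qed.

Lemma beta_inj la : part la -> injective (beta la).
Proof.
move=> /partP lap i j; rewrite /beta => E; apply/val_inj => /=.
have := ltn_ord i; have := ltn_ord j.
case: (ltngtP i j) => // ij; have := lap _ _ (ltnW ij); lia.
Qed.

Lemma rows_cons e r u e' :
  rows ((e, r) :: u) e' =1 if e' == e then incr (rows u e) r else rows u e'.
Proof.
move=> i; rewrite /rows /= xpair_eqE eq_sym; case: eqP => [->|] //=.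
by rewrite /incr eq_sym addnC.
Qed.

Lemma beta_rows_cons e r u e' : beta (rows ((e, r) :: u) e') =1
  if e' == e then incr (beta (rows u e)) r else beta (rows u e').
Proof.
by move=> i; rewrite /beta rows_cons; case: ifP => // _; rewrite /incr addnAC.
Qed.

Lemma big_vwordsS (V : nmodType) k (F : seq (step n) -> V) :
  \sum_(u <- vwords n k.+1) F u =
  \sum_(u <- vwords n k) \sum_(st : step n | addable u st) F (st :: u).
Proof.
rewrite /= big_flatten big_map; apply: eq_bigr => u _.
by rewrite big_map big_enum.
Qed.

Lemma mem_vwordsS k u (st : step n) : u \in vwords n k -> addable u st ->
  st :: u \in vwords n k.+1.
Proof.
move=> uk ad; apply/flattenP; exists [seq st :: u | st <- enum (addable u)].
  by apply/mapP; exists u.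
by apply/mapP; exists st; rewrite ?mem_enum.
Qed.

Lemma vwords_ind (Q : nat -> seq (step n) -> Prop) : Q 0 [::] ->
    (forall k u (st : step n), u \in vwords n k -> Q k u -> addable u st ->
      Q k.+1 (st :: u)) ->
  forall k u, u \in vwords n k -> Q k u.
Proof.
move=> Q0 QS; elim=> [|k IH] u; first by rewrite inE => /eqP->.
case/flattenP => _ /mapP[v vk ->] /mapP[st]; rewrite mem_enum => ad ->.
by apply: QS => //; apply: IH.
Qed.

Lemma size_vwords k u : u \in vwords n k -> size u = k.
Proof. by move: k u; apply: vwords_ind => // k u st _ /= ->. Qed.

Lemma part_vwords k u e : u \in vwords n k -> part (rows u e).
Proof.
move: k u; apply: vwords_ind => [|k u [e' r] _ IH ad].
  by apply/partP => i j _.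
case: (eqVneq e e') ad => [<- //|ee' _]; apply/partP => i j.
by rewrite !rows_cons (negbTE ee'); move/partP: IH; apply.
Qed.

Lemma sum_rows u : (\sum_e \sum_i rows u e i)%N = size u.
Proof.
rewrite pair_big /= /rows; elim: u => [|st u IH]; first by rewrite big1.
rewrite /= big_split /= -[(size u).+1]add1n; congr addn; last first.
  by rewrite -IH; apply: eq_bigr => -[].
rewrite (bigD1 st) //= big1 ?addn0 => [|[e i] /negbTE ne].
  by case: st => e i; rewrite eqxx.
by rewrite eq_sym ne.
Qed.

(** The obstruction is a row above of equal length; the shifted lengths then differ by one and a
    numerator of [rho] vanishes. Sums over addable rows thus extend to all rows. *)
Lemma rho_not_addable e r u : part (rows u e) -> ~~ addable u (e, r) ->
  rho R (beta (rows u e)) r = 0.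
Proof.
move=> /partP up; rewrite /addable /part; case/forallPn => i /forallPn[j].
rewrite !rows_cons eqxx /incr negb_imply -ltnNge => /andP[ij lt].
have le := up _ _ ij.
have jr : j = r.
  apply/eqP; apply: contraTT lt => /negbTE->; rewrite addn0 -leqNgt.
  exact: leq_trans le (leq_addr _ _).
subst j; have ri : i != r by apply: contraTneq lt => ->; rewrite ltnn.
rewrite eqxx (negbTE ri) /= in lt.
have ir : (i < r)%N by rewrite ltn_neqAle ri.
have r0 : (0 < r)%N by lia.
have r1n : (r.-1 < n)%N by have := ltn_ord r; lia.
have E : rows u e (Ordinal r1n) = rows u e r.
  have := up (Ordinal r1n) r; have := up i (Ordinal r1n) => /=; lia.
have jr : Ordinal r1n != r by rewrite -(inj_eq val_inj) /=; lia.
rewrite /rho (bigD1 (Ordinal r1n)) //=.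
have -> : beta (rows u e) (Ordinal r1n) = (beta (rows u e) r).+1.
  by rewrite /beta E /=; have := ltn_ord r; lia.
by rewrite subrr !mul0r mulr0.
Qed.

(** A nonempty last row would force at least [n] boxes. This supplies the shifted length 0 required
    by [sum_rho] and [sum_rho_mul]. *)
Lemma beta_last k u e r : u \in vwords n k -> (k < n)%N -> r.+1 = n ->
  beta (rows u e) r = 0%N.
Proof.
move=> uk kn rn; rewrite /beta rn subnn addn0.
apply/eqP; rewrite -leqn0 leqNgt; apply/negP => r0.
have up := partP _ (part_vwords e uk).
suff: (n <= k)%N by rewrite leqNgt kn.
rewrite -(size_vwords uk) -sum_rows (bigD1 e) //= -[n in (n <= _)%N]card_ord.
rewrite -sum1_card (leq_trans _ (leq_addr _ _)) // leq_sum // => i _.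
by rewrite (leq_trans r0) // up // -ltnS rn.
Qed.

Lemma moment0_vwords k u e : u \in vwords n k -> (k < n)%N ->
  moment R (beta (rows u e)) 0 = 1.
Proof.
move=> uk kn; have n0 : (0 < n)%N by lia.
have rn : (n.-1 < n)%N by lia.
have := @beta_last k u e (Ordinal rn) uk kn => /(_ (prednK n0)) l0.
rewrite -(sum_rho R (beta_inj (part_vwords e uk)) l0).
by apply: eq_bigr => r _; rewrite expr0 mulr1.
Qed.

Lemma moment1_vwords k u e : u \in vwords n k -> (k < n)%N ->
  moment R (beta (rows u e)) 1 = 0.
Proof.
move=> uk kn; have n0 : (0 < n)%N by lia.
have rn : (n.-1 < n)%N by lia.
have := @beta_last k u e (Ordinal rn) uk kn => /(_ (prednK n0)) l0.
have li := beta_inj (part_vwords e uk).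
rewrite /moment /cont; under eq_bigr do rewrite expr1 mulrBr.
by rewrite sumrB (sum_rho_mul R li l0) -mulr_suml (sum_rho R li l0) mul1r subrr.
Qed.

(** The only box that fits in the empty diagram has content 0. *)
Lemma moment_nil e k : moment R (beta (@rows n [::] e)) k.+1 = 0.
Proof.
rewrite /moment big1 // => r _; have [r0|r0] := posnP r.
  by rewrite /cont /beta /= r0 subn1 add0n subrr expr0n mulr0.
rewrite rho_not_addable ?mul0r //; first by apply/partP.
apply/negP => /partP /(_ (Ordinal (leq_ltn_trans (leq0n r) (ltn_ord r))) r).
rewrite !rows_cons eqxx /incr eqxx /= => /(_ isT).
by case: eqVneq => // E; move: r0; rewrite -E.
Qed.

(** Either the row below has the same length, so that a numerator vanishes, or [r] is the last row
    and is empty. *)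
Lemma sigma_eq0 la r : part la ->
  ~~ ((0 < la r)%N && part (fun i => la i - (i == r))%N) ->
  sigma R (beta la) r = 0.
Proof.
move=> /partP lap nr; rewrite /sigma.
have [lr|lr] := posnP (beta la r); first by rewrite lr mul0r.
have [r1n|r1n] := ltnP r.+1 n; last first.
  have rn : r.+1 = n by have := ltn_ord r; lia.
  move: lr; rewrite /beta rn subnn addn0 => lr; case/negP: nr; rewrite lr /=.
  apply/partP => i j ij; case: (eqVneq i r) => [ir|ir].
    suff -> : j = r by rewrite ir eqxx.
    by apply/val_inj => /=; move: ij; rewrite ir; have := ltn_ord j; lia.
  by rewrite subn0 (leq_trans (leq_subr _ _)) ?lap.
pose s := Ordinal r1n; suff E : la s = la r.
  have sr : s != r by rewrite -(inj_eq val_inj) /=; lia.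
  rewrite (bigD1 s) //= /beta E /=.
  have -> : (la r + (n - r.+1))%N = (la r + (n - r.+2)).+1 by lia.
  by rewrite -natr1 addrK subrr !mul0r mulr0.
apply/eqP; rewrite eqn_leq lap //=; case: leqP => // sr; case/negP: nr.
rewrite (leq_ltn_trans _ sr) //=; apply/partP => i j ij.
case: (eqVneq i r) => [ir|ir]; last by rewrite subn0 (leq_trans (leq_subr _ _)) ?lap.
case: (eqVneq j r) => [->|jr]; first by rewrite ir.
have : (la j <= la s)%N.
  rewrite lap //=; move: jr; rewrite -(inj_eq val_inj) /=; move: ij; rewrite ir; lia.
rewrite ir /=; lia.
Qed.

Definition same_rows (la : bool -> 'I_n -> nat) u : bool :=
  [forall e, forall i, rows u e i == la e i].

Lemma same_rowsP (la : bool -> 'I_n -> nat) u :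
  reflect (forall e i, rows u e i = la e i) (same_rows la u).
Proof.
apply: (iffP forallP) => [h e i|h e]; first by apply/eqP; move/forallP: (h e); apply.
by apply/forallP => i; apply/eqP.
Qed.

Let dec (la : bool -> 'I_n -> nat) (st : step n) e i : nat :=
  (la e i - ((e, i) == st))%N.

(** Taking off the last step [st] leaves a word of shape [dec la st]; if that box cannot be removed,
    no such word exists. *)
Lemma big_same_rows k (la : bool -> 'I_n -> nat) (st : step n) :
    (forall e, part (la e)) ->
  \sum_(u <- vwords n k) (addable u st && same_rows la (st :: u))%:R =
  (if (0 < la st.1 st.2)%N && part (dec la st st.1)
   then (count (same_rows (dec la st)) (vwords n k))%:R else 0) :> R.
Proof.
case: st => e r lap /=.
have E u : same_rows la ((e, r) :: u) =
    (0 < la e r)%N && same_rows (dec la (e, r)) u.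
  apply/same_rowsP/andP => [h|[r0 /same_rowsP h] e' i].
    split; first by rewrite -h rows_cons eqxx /incr eqxx addn1.
    apply/same_rowsP => e' i; rewrite /dec -h rows_cons xpair_eqE.
    by case: eqVneq => [->|_] /=; rewrite ?subn0 // /incr addnK.
  rewrite rows_cons; case: eqVneq => [->|ee']; rewrite /incr h /dec xpair_eqE.
    by rewrite eqxx /=; case: eqVneq => [->|_] /=; rewrite ?subnK // subn0 addn0.
  by rewrite (negbTE ee') subn0.
case: ifP => [/andP[r0 pd]|nr].
  rewrite -sum1_count natr_sum [RHS]big_mkcond; apply: eq_bigr => u _ /=.
  rewrite E r0 /=; case: (same_rowsP (dec la (e, r)) u) => h; rewrite ?andbF //.
  suff -> : addable u (e, r) by [].
  have h' : same_rows la ((e, r) :: u) by rewrite E r0; apply/same_rowsP.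
  apply/partP => i j ij; rewrite !(same_rowsP _ _ h').
  by move/partP: (lap e); apply.
rewrite big1_seq // => u /andP[_ uk].
rewrite E; case: (same_rowsP _ u) => h; rewrite ?andbF //.
have : part (dec la (e, r) e).
  by apply/partP => i j ij; rewrite -!h; move/partP: (part_vwords e uk); apply.
by move: nr => /negbT; rewrite negb_and => /orP[/negbTE->|/negP//]; rewrite andbF.
Qed.

(** Frobenius' formula for bitableaux, by induction on the last box: a removal multiplies the
    product by [sigma], and over all rows of both diagrams the [sigma] add up to the number of
    boxes. The square on the left compensates the constant left out of [vdm]. *)
Lemma count_same_rows k (la : bool -> 'I_n -> nat) :
    (forall e, part (la e)) -> (\sum_e \sum_i la e i)%N = k ->
  (count (same_rows la) (vwords n k))%:R * vdm R (beta (fun _ : 'I_n => 0%N)) ^+ 2 =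
  k`!%:R * \prod_e vdm R (beta (la e)).
Proof.
elim: k la => [|k IH] la lap lak.
  have la0 e i : la e i = 0%N.
    have := lak => /eqP; rewrite sum_nat_eq0 => /forallP/(_ e)/=.
    by rewrite sum_nat_eq0 => /forallP/(_ i)/= /eqP.
  rewrite /= addn0 (_ : same_rows _ _ = true); last by apply/same_rowsP => e i.
  rewrite (eq_bigr (fun=> vdm R (beta (fun _ : 'I_n => 0%N)))) => [|e _].
    by rewrite prodr_const card_bool.
  by apply: eq_vdm => i; rewrite /beta la0.
rewrite -sum1_count natr_sum big_mkcond.
rewrite big_vwordsS /=; under eq_bigr do rewrite big_mkcond.
rewrite exchange_big /=.
pose S (st : step n) := sigma R (beta (la st.1)) st.2.
have E (st : step n) :
    (\sum_(u <- vwords n k) (addable u st && same_rows la (st :: u))%:R) *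
      vdm R (beta (fun _ : 'I_n => 0%N)) ^+ 2 =
    k`!%:R * (S st * \prod_e vdm R (beta (la e))).
  rewrite big_same_rows //; case: ifP => [/andP[r0 pd]|/negbT nr]; last first.
    rewrite /S sigma_eq0 ?mul0r ?mulr0 //.
    apply: contra nr => /andP[-> /partP h]; apply/partP => i j ij.
    by have := h i j ij; rewrite /dec; case: (st) => e r; rewrite !xpair_eqE /= eqxx.
  rewrite /S; case: st r0 pd => e r /= r0 pd.
  have ne : (~~ e) != e by case: (e).
  have pd' e' : part (dec la (e, r) e').
    case: (eqVneq e' e) => [->//|ee']; apply/partP => i j ij.
    by rewrite /dec !xpair_eqE (negbTE ee') !subn0; move/partP: (lap e'); apply.
  have inc : beta (la e) =1 incr (beta (dec la (e, r) e)) r.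
    move=> i; rewrite /beta /incr /dec xpair_eqE eqxx /=.
    by case: eqVneq => [->|_]; lia.
  rewrite IH //; last first.
    have := lak; rewrite 2!pair_big /= (bigD1 (e, r)) //= => lak'.
    rewrite (bigD1 (e, r)) //= {1}/dec eqxx.
    rewrite (eq_bigr (fun p => la p.1 p.2)); last first.
      by move=> [e' i] /= ne'; rewrite /dec (negbTE ne') subn0.
    by lia.
  congr (_ * _); rewrite (bigD1 e) //= [in RHS](bigD1 e) //= mulrA.
  congr (_ * _); last first.
    apply: eq_bigr => e' ee'; apply: eq_vdm => i.
    by rewrite /beta /dec xpair_eqE (negbTE ee') subn0.
  have inj' : injective (incr (beta (dec la (e, r) e)) r).
    by move=> i j; rewrite -!inc => /(beta_inj (lap e)).
  rewrite -(sigma_incr R (beta_inj pd) inj') (eq_vdm R inc); congr (_ * _).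
  rewrite /sigma !inc; congr (_ * _); apply: eq_bigr => j _.
  by rewrite !inc.
transitivity (\sum_(st : step n) k`!%:R * (S st * \prod_e vdm R (beta (la e)))).
  rewrite mulr_suml; apply: eq_bigr => st _; rewrite -E; congr (_ * _).
  apply: eq_bigr => u _; case: addable => //=; by case: same_rows.
rewrite -mulr_sumr -mulr_suml mulrA; congr (_ * _).
rewrite factS natrM mulrC; congr (_ * _).
rewrite -(pair_big xpredT xpredT (fun e i => S (e, i))) /= /S /=.
rewrite -lak natr_sum; apply: eq_bigr => e _.
(* The shifts [n - i.+1] in [beta] add up to ['C(n, 2)], which cancels. *)
rewrite (sum_removals R (beta_inj (lap e))) -natr_sum.
rewrite /beta big_split /= [X in (_ + X)%N](reindex_inj rev_ord_inj) /=.
rewrite [X in (_ + X)%N](eq_bigr (fun i : 'I_n => i : nat)) => [|i _]; last first.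
  by have := ltn_ord i; lia.
by rewrite -(big_mkord xpredT id) bin2_sum natrD addrK.
Qed.

(** The growth process behind the trace: a fair choice of diagram, then a row drawn with the
    transition measure. *)
Fixpoint prob u : R :=
  if u is (e, r) :: u' then prob u' * (rho R (beta (rows u' e)) r / 2) else 1.

Lemma prob_vdm k u : u \in vwords n k ->
  prob u * 2 ^+ k * vdm R (beta (fun _ : 'I_n => 0%N)) ^+ 2 =
  \prod_e vdm R (beta (rows u e)).
Proof.
move: k u; apply: vwords_ind => [|k u [e r] uk IH ad].
  rewrite mulr1 mul1r (eq_bigr (fun=> vdm R (beta (fun _ : 'I_n => 0%N)))) //.
  by rewrite prodr_const card_bool.
rewrite (bigD1 e) //= (eq_vdm R (beta_rows_cons e r u e)) eqxx.
rewrite vdm_incr ?(beta_inj (part_vwords e uk)) //; last first.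
  exact: beta_inj (part_vwords e uk).
rewrite (eq_bigr (fun e' => vdm R (beta (rows u e')))) => [|e' ee']; last first.
  by rewrite (eq_vdm R (beta_rows_cons e r u e')) (negbTE ee').
by rewrite (bigD1 e) //= in IH; rewrite -[RHS]mulrA -IH exprS; field.
Qed.

(** The factor is the order of B_k, so the weight of a word depends only on its final shape. *)
Lemma prob_count k u : u \in vwords n k ->
  (2 ^ k * k`!)%:R * prob u = (count (same_rows (rows u)) (vwords n k))%:R.
Proof.
move=> uk; pose D := vdm R (beta (fun _ : 'I_n => 0%N)) ^+ 2.
have D0 : D != 0.
  by rewrite expf_neq0 // vdm_neq0 //; apply/beta_inj/partP => i j _.
apply: (mulIf D0); rewrite count_same_rows ?sum_rows ?(size_vwords uk) //; last first.
  by move=> e; apply: part_vwords uk.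
by rewrite -(prob_vdm uk) natrM natrX -/D; ring.
Qed.

End Words.

(** * The group algebra and its conditional expectations *)

Definition galg (R : nzRingType) (gT : finGroupType) : Type := {ffun gT -> R^o}.

Section GroupAlgebra.
Variables (R : comNzRingType) (gT : finGroupType).

HB.instance Definition _ := GRing.Lmodule.on (galg R gT).

Implicit Types (a b c : galg R gT) (g h : gT).

Definition gdelta g : galg R gT := [ffun h => (h == g)%:R].

Definition gmul a b : galg R gT := [ffun g => \sum_h a h * b (h^-1 * g)%g].

Lemma gmulA : associative gmul.
Proof.
move=> a b c; apply/ffunP => g; rewrite !ffunE.
under eq_bigr do rewrite ffunE mulr_sumr.
under [RHS]eq_bigr do rewrite ffunE mulr_suml.
rewrite [RHS]exchange_big /=; apply: eq_bigr => h _.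
rewrite [RHS](reindex_inj (mulgI h)); apply: eq_bigr => k _.
by rewrite mulKg mulrA invMg mulgA.
Qed.

Lemma gmul1 : left_id (gdelta 1%g) gmul.
Proof.
move=> a; apply/ffunP => g; rewrite ffunE (bigD1 1%g) //= ffunE eqxx mul1r.
by rewrite invg1 mul1g big1 ?addr0 // => h /negbTE h1; rewrite ffunE h1 mul0r.
Qed.

Lemma gmulg1 : right_id (gdelta 1%g) gmul.
Proof.
move=> a; apply/ffunP => g; rewrite ffunE (bigD1 g) //= ffunE mulVg eqxx mulr1.
rewrite big1 ?addr0 // => h hg; rewrite ffunE -eq_invg_mul invgK (negbTE hg).
by rewrite mulr0.
Qed.

Lemma gmulDl : left_distributive gmul +%R.
Proof.
move=> a b c; apply/ffunP => g; rewrite !ffunE -big_split.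
by apply: eq_bigr => h _; rewrite ffunE mulrDl.
Qed.

Lemma gmulDr : right_distributive gmul +%R.
Proof.
move=> a b c; apply/ffunP => g; rewrite !ffunE -big_split.
by apply: eq_bigr => h _; rewrite ffunE mulrDr.
Qed.

Lemma gdelta1_neq0 : gdelta 1%g != 0.
Proof.
apply/eqP => /ffunP/(_ 1%g)/eqP; rewrite !ffunE eqxx; apply/negP.
exact: oner_neq0.
Qed.

HB.instance Definition _ := GRing.Zmodule_isNzRing.Build (galg R gT)
  gmulA gmul1 gmulg1 gmulDl gmulDr gdelta1_neq0.

Lemma galg_mulE a b g : (a * b) g = \sum_h a h * b (h^-1 * g)%g.
Proof. by rewrite ffunE. Qed.

Lemma galg1E : 1 = gdelta 1%g :> galg R gT. Proof. by []. Qed.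

Lemma galg_scaleE (x : R) a g : (x *: a) g = x * a g.
Proof. by rewrite ffunE. Qed.

Lemma galg_scaleAl (x : R) a b : x *: (a * b) = (x *: a) * b.
Proof.
apply/ffunP => g; rewrite galg_scaleE !galg_mulE mulr_sumr.
by apply: eq_bigr => h _; rewrite galg_scaleE mulrA.
Qed.

Lemma galg_scaleAr (x : R) a b : x *: (a * b) = a * (x *: b).
Proof.
apply/ffunP => g; rewrite galg_scaleE !galg_mulE mulr_sumr.
by apply: eq_bigr => h _; rewrite galg_scaleE mulrCA.
Qed.

HB.instance Definition _ :=
  GRing.Lmodule_isLalgebra.Build R (galg R gT) galg_scaleAl.
HB.instance Definition _ :=
  GRing.Lalgebra_isAlgebra.Build R (galg R gT) galg_scaleAr.

Lemma gdeltaM g h : gdelta g * gdelta h = gdelta (g * h)%g.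
Proof.
apply/ffunP => k; rewrite galg_mulE (bigD1 g) //= !ffunE eqxx mul1r.
rewrite big1 ?addr0 => [|i /negbTE ig]; last by rewrite ffunE ig mul0r.
by rewrite -(inj_eq (mulgI g)) mulKVg.
Qed.

Lemma gdelta_mulE g a h : (gdelta g * a) h = a (g^-1 * h)%g.
Proof.
rewrite galg_mulE (bigD1 g) //= ffunE eqxx mul1r big1 ?addr0 // => i /negbTE ig.
by rewrite ffunE ig mul0r.
Qed.

Lemma mul_gdeltaE g a h : (a * gdelta g) h = a (h * g^-1)%g.
Proof.
rewrite galg_mulE (bigD1 (h * g^-1)%g) //= ffunE invMg invgK mulgKV eqxx mulr1.
rewrite big1 ?addr0 // => i ig; rewrite ffunE -(inj_eq (mulgI i)) mulKVg.
by case: (h =P (i * g)%g) ig => [->|_ _]; rewrite ?mulgK ?eqxx // mulr0.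
Qed.

Lemma galg_expand a : a = \sum_g a g *: gdelta g.
Proof.
apply/ffunP => g; rewrite sum_ffunE (bigD1 g) //= !ffunE eqxx big1 => [|h hg].
  by rewrite addr0 /GRing.scale /= mulr1.
by rewrite !ffunE eq_sym (negbTE hg) /GRing.scale /= mulr0.
Qed.

Definition supp (H : {set gT}) a := forall g, g \notin H -> a g = 0.

(** The conditional expectation onto the algebra of [H]: left linear over that algebra ([restrM])
    and trace preserving ([restr_at1]). *)
Definition restr (H : {set gT}) a : galg R gT := [ffun g => if g \in H then a g else 0].

Lemma restrE H a g : restr H a g = if g \in H then a g else 0.
Proof. by rewrite ffunE. Qed.

Section Support.
Variable H : {group gT}.

Lemma supp1 : supp H 1.
Proof. by move=> g gH; rewrite galg1E ffunE; case: eqP gH => // ->; rewrite group1. Qed.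

Lemma suppD a b : supp H a -> supp H b -> supp H (a + b).
Proof. by move=> sa sb g gH; rewrite ffunE sa ?sb ?addr0. Qed.

Lemma suppZ (x : R) a : supp H a -> supp H (x *: a).
Proof. by move=> sa g gH; rewrite ffunE sa // scaler0. Qed.

Lemma suppM a b : supp H a -> supp H b -> supp H (a * b).
Proof.
move=> sa sb g gH; rewrite galg_mulE big1 // => h _.
have [hH|hH] := boolP (h \in H); last by rewrite sa ?mul0r.
by rewrite sb ?mulr0 // groupMl ?groupV.
Qed.

Lemma suppX a k : supp H a -> supp H (a ^+ k).
Proof.
by move=> sa; elim: k => [|k IH]; rewrite ?expr0 ?exprS; [apply: supp1|apply: suppM].
Qed.

Lemma supp_sum (I : finType) (P : pred I) (F : I -> galg R gT) :
  (forall i, P i -> supp H (F i)) -> supp H (\sum_(i | P i) F i).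
Proof. by move=> sF g gH; rewrite sum_ffunE big1 // => i Pi; apply: sF. Qed.

Lemma supp_gdelta g : g \in H -> supp H (gdelta g).
Proof. by move=> gH h hH; rewrite ffunE; case: eqP hH => // ->; rewrite gH. Qed.

Lemma restr_id a : supp H a -> restr H a = a.
Proof.
by move=> sa; apply/ffunP => g; rewrite ffunE; case: ifP => // /negbT/sa.
Qed.

Lemma restrD a b : restr H (a + b) = restr H a + restr H b.
Proof. by apply/ffunP => g; rewrite !ffunE; case: ifP; rewrite ?addr0. Qed.

Lemma restrZ (x : R) a : restr H (x *: a) = x *: restr H a.
Proof. by apply/ffunP => g; rewrite !ffunE; case: ifP; rewrite ?scaler0. Qed.

Lemma restr_is_zmod_morphism : zmod_morphism (restr H).
Proof. by move=> a b; rewrite -scaleN1r restrD restrZ scaleN1r. Qed.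

HB.instance Definition _ := GRing.isZmodMorphism.Build (galg R gT) (galg R gT)
  (restr H) restr_is_zmod_morphism.

Lemma restrM a b : supp H a -> restr H (a * b) = a * restr H b.
Proof.
move=> sa; apply/ffunP => g; rewrite ffunE galg_mulE; case: ifP => gH.
  rewrite galg_mulE; apply: eq_bigr => h _.
  have [hH|hH] := boolP (h \in H); last by rewrite sa ?mul0r.
  by rewrite ffunE groupMl ?groupV // gH.
rewrite galg_mulE big1 // => h _.
have [hH|hH] := boolP (h \in H); last by rewrite sa ?mul0r.
by rewrite ffunE groupMl ?groupV // gH mulr0.
Qed.

Lemma restr_at1 a : (restr H a) 1%g = a 1%g.
Proof. by rewrite ffunE group1. Qed.

Lemma supp_comm (a b : galg R gT) : supp H a ->
  (forall g, g \in H -> GRing.comm (gdelta g) b) -> GRing.comm a b.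
Proof.
move=> sa cb; rewrite (galg_expand a) /GRing.comm mulr_suml mulr_sumr.
apply: eq_bigr => g _; rewrite -scalerAl -scalerAr.
have [gH|gH] := boolP (g \in H); first by rewrite cb.
by rewrite sa // !scale0r.
Qed.

End Support.
End GroupAlgebra.

(** * Conjugating powers of a Jucys-Murphy element, in an abstract ring *)

Section HeckeRelation.
(** Here [s] stands for the transposition of two consecutive indices, [x] and [y] for their
    Jucys-Murphy elements, [p] and [q] for their sign projectors, and [e] for the projector on equal
    signs. *)
Variables (A : nzRingType) (s x y : A) (p q : bool -> A).
Hypotheses (ss : s * s = 1) (sp : forall e, s * p e * s = q e).
Hypotheses (xy : GRing.comm x y) (pq : forall e e', GRing.comm (p e) (q e')).
Hypotheses (px : forall e, GRing.comm (p e) x).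
Hypotheses (xq : forall e, GRing.comm x (q e)).
Hypothesis pp : forall e e', p e * p e' = if e == e' then p e else 0.
Hypothesis qq : forall e e', q e * q e' = if e == e' then q e else 0.
Variable e : A.
Hypothesis eE : e = p false * q false + p true * q true.
Hypothesis yE : y = s * x * s + s * e.

Let ps b : p b * s = s * q b. Proof. by rewrite -sp !mulrA ss mul1r. Qed.
Let sp' b : s * p b = q b * s. Proof. by rewrite -sp -[RHS]mulrA ss mulr1. Qed.

Let es : e * s = s * e.
Proof.
have c b : p b * q b * s = s * (p b * q b).
  by rewrite -mulrA -sp' mulrA ps -mulrA pq.
by rewrite eE mulrDl mulrDr !c.
Qed.

Lemma mul_agree b : q b * e = p b * q b.
Proof.
by rewrite eE mulrDr !pq !mulrA !qq; case: b; rewrite /= ?mul0r ?addr0 ?add0r.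
Qed.

Let ee : e * e = e.
Proof.
by rewrite {1}eE mulrDl -!mulrA !mul_agree !mulrA !pp -eE.
Qed.

Let ex : e * x = x * e.
Proof. by rewrite eE mulrDl mulrDr -!mulrA -!xq !mulrA !px. Qed.

Let sy : s * y = x * s + e.
Proof. by rewrite yE mulrDr !mulrA ss !mul1r. Qed.

(* [hsum], [gsum] and [rsum] are the coefficients in 1/z of
   1/((z - x)(z - y)), 1/((z - x)^2 (z - y)) and 1/(z - x) s 1/(z - x). *)
Fixpoint hsum k : A := if k is k'.+1 then x * hsum k' + y ^+ k' else 0.
Fixpoint gsum k : A := if k is k'.+1 then x * gsum k' + hsum k' else 0.
Fixpoint rsum k : A := if k is k'.+1 then x * rsum k' + s * x ^+ k' else 0.
Let dsum k : A := (x ^+ k.-1) *+ k.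

Let dsumS k : dsum k.+1 = x * dsum k + x ^+ k.
Proof. by case: k => [|k]; rewrite /dsum ?mulr0 ?add0r //= mulrnAr -exprS -mulrSr. Qed.

Let hsum_y k : hsum k * y = x * hsum k + y ^+ k - x ^+ k.
Proof.
elim: k => [|k IH] /=; first by rewrite mul0r mulr0 add0r subrr.
rewrite mulrDl -mulrA IH -exprSr mulrBr -exprS.
by rewrite addrAC.
Qed.

Let gsum_y k : gsum k * y = x * gsum k + hsum k - dsum k.
Proof.
elim: k => [|k IH]; first by rewrite /dsum /= mul0r mulr0 mulr0n add0r subrr.
rewrite dsumS /= mulrDl -mulrA IH hsum_y !(mulrBr, mulrDr) -!addrA.
congr (_ + (_ + _)).
by rewrite addrC -!addrA opprD; congr (_ + (_ + _)); rewrite addrC.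
Qed.

Let rsum_y k : rsum k * y = x * rsum k + e * dsum k.
Proof.
elim: k => [|k IH]; first by rewrite /dsum /= mul0r mulr0 mulr0n mulr0 addr0.
have xky : x ^+ k * y = y * x ^+ k by apply/commr_sym/commrX.
rewrite dsumS /= mulrDl -!mulrA xky [s * (y * _)]mulrA sy IH.
rewrite !(mulrDr, mulrDl) [e * (x * _)]mulrA ex -!mulrA -!addrA; congr (_ + _).
by rewrite addrCA.
Qed.

(** In resolvent form, s (z - x)^-1 s = (z - y)^-1 - e ((z - x)^-1 s (z - x)^-1 + (z - x)^-2 (z -
    y)^-1). The induction multiplies on the right by s x s = y - s e. In [gsum] the powers of [x]
    stand left of those of [y], so that an expectation can release them. *)
Lemma conj_pow k : s * x ^+ k * s = y ^+ k - e * (rsum k + gsum k).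
Proof.
elim: k => [|k IH]; first by rewrite /= addr0 mulr0 subr0 !expr0 mulr1 ss.
have -> : s * x ^+ k.+1 * s = s * x ^+ k * s * y - e * (s * x ^+ k).
  rewrite [in RHS]yE mulrDr.
  have -> : s * x ^+ k * s * (s * x * s) = s * x ^+ k.+1 * s.
    by rewrite exprSr !mulrA -(mulrA _ s s) ss mulr1.
  have -> : s * x ^+ k * s * (s * e) = e * (s * x ^+ k).
    rewrite mulrA -(mulrA _ s s) ss mulr1 -mulrA -(commrX k ex) !mulrA.
    by rewrite es.
  by rewrite addrK.
rewrite IH mulrBl -exprSr -addrA -opprD -mulrA -mulrDr; congr (_ - _) => /=.
rewrite mulrDl rsum_y gsum_y.
have -> : x * rsum k + e * dsum k + (x * gsum k + hsum k - dsum k) + s * x ^+ k =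
   (x * rsum k + s * x ^+ k + (x * gsum k + hsum k)) + (e * dsum k - dsum k).
  move: (x * rsum k) (e * dsum k) (x * gsum k) (hsum k) (s * x ^+ k) => a b c d f.
  by rewrite (AC (2*3*1) ((1*6)*(3*4)*(2*5))).
(* Idempotence of [e] removes the terms [dsum], the coefficients of 1/(z - x)^2. *)
by rewrite [LHS]mulrDr mulrBr mulrA ee subrr addr0.
Qed.

(** This is multiplication of 1/((z - x)^2 (z - y)) by (z - x)^2. *)
Lemma gsum_rec k : x ^+ 2 * gsum k - x * gsum k.+1 *+ 2 + gsum k.+2 = y ^+ k.
Proof.
rewrite /= !mulrDr !mulrA -expr2; move: (x ^+ 2 * _) (x * hsum k) (y ^+ k) => a b c.
rewrite mulr2n opprD !addrA -[_ + a + b]addrA subrK opprD addrA subrr add0r.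
by rewrite addNr add0r.
Qed.

Section Expectation.
Variables (E : {additive A -> A}) (S : A -> Prop).
Hypotheses (S1 : S 1) (SM : forall a b, S a -> S b -> S (a * b)).
Hypotheses (Sx : S x) (Sp : forall b, S (p b)).
Hypothesis EM : forall a b, S a -> E (a * b) = a * E b.
Hypothesis Es : forall a, S a -> E (s * a) = 0.

Let SX k : S (x ^+ k).
Proof. by elim: k => [|k IH]; rewrite ?expr0 // exprS; apply: SM. Qed.

(** Each term is x^a s x^b. Moved to the right, [q b] passes x^a and becomes [p b] across [s], which
    leaves [s] between two elements of [S]. *)
Let E_rsum b k c : S c -> E (c * (q b * rsum k)) = 0.
Proof.
elim: k c => [|k IH] c Sc /=; first by rewrite !mulr0 raddf0.
rewrite mulrDr [q b * _]mulrA -xq -mulrA mulrDr raddfD [c * (x * _)]mulrA.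
rewrite IH ?add0r; last exact: SM.
by rewrite [q b * _]mulrA -sp' -mulrA EM // Es ?mulr0 //;
  apply: SM; [apply: Sp | apply: SX].
Qed.

Let E_conj b k : E (s * (p b * x ^+ k) * s) = E (q b * y ^+ k) - p b * E (q b * gsum k).
Proof.
have -> : s * (p b * x ^+ k) * s = q b * (s * x ^+ k * s).
  by rewrite !mulrA sp'.
rewrite conj_pow mulrBr [q b * (e * _)]mulrA mul_agree -mulrA mulrDr mulrDr.
by rewrite raddfB raddfD (E_rsum _ _ (Sp b)) add0r (EM _ (Sp b)).
Qed.

(* The moments of [y] conditioned on the subring [S] satisfy a linear
   recurrence driven by those of [x]. *)
Lemma expectation_rec b k :
  E (s * (p b * x ^+ k.+2) * s) - x * E (s * (p b * x ^+ k.+1) * s) *+ 2 +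
    x ^+ 2 * E (s * (p b * x ^+ k) * s) =
  E (q b * y ^+ k.+2) - x * E (q b * y ^+ k.+1) *+ 2 + x ^+ 2 * E (q b * y ^+ k) -
    p b * E (q b * y ^+ k).
Proof.
have G : E (q b * y ^+ k) = x ^+ 2 * E (q b * gsum k) - x * E (q b * gsum k.+1) *+ 2
    + E (q b * gsum k.+2).
  rewrite -gsum_rec mulrDr mulrBr mulrnAr raddfD raddfB raddfMn.
  rewrite [q b * (x ^+ 2 * _)]mulrA (commrX 2 (commr_sym (xq b))).
  by rewrite [q b * (x * _)]mulrA -[q b * x]xq -[x ^+ 2 * _ * _]mulrA -[x * _ * _]mulrA
    (EM _ (SX 2)) (EM _ Sx).
(* The unknown expectations with [gsum] are eliminated: combined as in (z - x)^2, they sum to the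
   expectation with [y ^+ k]. *)
have -> : p b * E (q b * y ^+ k) = x ^+ 2 * (p b * E (q b * gsum k)) -
    x * (p b * E (q b * gsum k.+1)) *+ 2 + p b * E (q b * gsum k.+2).
  rewrite G mulrDr mulrBr mulrnAr [p b * (x ^+ 2 * _)]mulrA (commrX 2 (px b)).
  by rewrite [p b * (x * _)]mulrA px -[x ^+ 2 * _ * _]mulrA -[x * _ * _]mulrA.
rewrite !E_conj !(mulrBr x) (mulrBr (x ^+ 2)) mulrnBl.
have shuffle (a c d f g h : A) :
    a - f - (c - g) + (d - h) = a - c + d - (h - g + f).
  by rewrite !opprD !opprK (AC (2*2*2) ((1*3*5)*((6*4)*2))).
exact: shuffle.
Qed.

End Expectation.
End HeckeRelation.

(** * The chain of subgroups B_k and their reflections *)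

(** The copy of B_k in B_n that moves only the letters of index below [k]. *)
Definition hyp_fix n k : {set {perm signed n}} :=
  [set s in hyperoct n | [forall x : signed n, (k <= x.2)%N ==> (s x == x)]].

Lemma hyp_fixP n k (s : {perm signed n}) :
  reflect ((forall x, s (sopp x) = sopp (s x)) /\
           forall x : signed n, (k <= x.2)%N -> s x = x)
          (s \in hyp_fix n k).
Proof.
rewrite !inE; apply: (iffP andP) => [[/forallP so /forallP sk]|[so sk]].
  by split=> x; [apply/eqP/so | move=> kx; apply/eqP; move: (sk x); rewrite kx].
split; apply/forallP => x; first by rewrite so.
by apply/implyP => kx; rewrite sk.
Qed.

Lemma hyp_fix_group_set n k : group_set (hyp_fix n k).
Proof.
apply/group_setP; split=> [|s t /hyp_fixP[so sk] /hyp_fixP[t_o tk]].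
  by apply/hyp_fixP; split=> x; rewrite !perm1.
apply/hyp_fixP; split=> x; rewrite !permM; first by rewrite so t_o.
by move=> kx; rewrite sk ?tk.
Qed.
Canonical hyp_fix_group n k := Group (@hyp_fix_group_set n k).

Lemma hyp_fix_lt n k (s : {perm signed n}) (x : signed n) :
  s \in hyp_fix n k -> ((s x).2 < k)%N = (x.2 < k)%N.
Proof.
move=> /hyp_fixP[_ sk]; case: (ltnP x.2 k) => [xk|kx]; last by rewrite sk // ltnNge kx.
rewrite ltnNge; apply/negP => ksx; have /perm_inj E := sk _ ksx.
by rewrite E leqNgt xk in ksx.
Qed.

Lemma hyp_fixn n : hyp_fix n n = hyperoct n.
Proof.
apply/setP => s; rewrite inE andb_idr // => _; apply/forallP => x.
by apply/implyP; rewrite leqNgt ltn_ord.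
Qed.

Lemma hyp_fix_sub n k m : (k <= m)%N -> hyp_fix n k \subset hyp_fix n m.
Proof.
move=> km; apply/subsetP => s /hyp_fixP[so sk]; apply/hyp_fixP; split=> // x mx.
by apply/sk/(leq_trans km).
Qed.

(* The reflection exchanging [v] and [j] (and [-v] and [-j]). *)
Definition refl n (v : signed n) (j : 'I_n) : {perm signed n} :=
  if v.1 then neg_transp v.2 j else transp v.2 j.

Lemma reflE n (v : signed n) (j : 'I_n) x : v.2 != j ->
  refl v j x = (x.1 (+) (v.1 && ((x.2 == v.2) || (x.2 == j))), tperm v.2 j x.2).
Proof.
move=> vj; rewrite /refl; case: v.1; first by rewrite neg_transpE.
by rewrite transpE addbF.
Qed.

Lemma refl_hyperoct n (v : signed n) (j : 'I_n) : refl v j \in hyperoct n.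
Proof.
by rewrite /refl; case: v.1; [apply: neg_transp_hyperoct | apply: sym_perm_hyperoct].
Qed.

Lemma refl_fix n (v : signed n) (j : 'I_n) : (v.2 < j)%N -> refl v j \in hyp_fix n j.+1.
Proof.
move=> vj; have := refl_hyperoct v j; rewrite inE => /forallP ro.
apply/hyp_fixP; split=> x; first exact/eqP.
move=> jx; have xj : x.2 != j by rewrite -(inj_eq val_inj) neq_ltn jx orbT.
have xv : x.2 != v.2 by rewrite -(inj_eq val_inj) neq_ltn (ltn_trans vj jx) orbT.
rewrite reflE ?neq_ltn ?vj // (negbTE xj) (negbTE xv) andbF addbF.
by rewrite tpermD 1?eq_sym //; case: x {jx xj xv}.
Qed.

(** Indexing by a signed letter makes conjugation equivariant: [g] fixes [j] and carries [v] to
    [g v], so it permutes the reflections summed in [jm]. *)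
Lemma conj_refl n k (g : {perm signed n}) (v : signed n) (j : 'I_n) :
    g \in hyp_fix n k -> (k <= j)%N -> (v.2 < k)%N ->
  (refl v j * g)%g = (g * refl (g v) j)%g.
Proof.
move=> gk kj vk; have [go gid] := hyp_fixP _ _ gk.
have vj : v.2 != j by rewrite -(inj_eq val_inj) neq_ltn (leq_trans vk kj).
have gvj : (g v).2 != j.
  by rewrite -(inj_eq val_inj) neq_ltn (leq_trans _ kj) // hyp_fix_lt.
have gsop x y : x.2 = y.2 -> g y = (y.1 (+) x.1 (+) (g x).1, (g x).2).
  case: x y => [b i] [c i'] /= ->; case: (eqVneq b c) => [->|bc].
    by rewrite addbb addFb; case: (g _).
  have -> : (c, i') = sopp (b, i') :> signed n.
    by rewrite /sopp /=; case: (b) (c) bc => -[].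
  by rewrite go /sopp /=; case: (g _) => d i''; move: bc; case: b; case: c; case: d.
have gj (b : bool) : g (b, j) = (b, j) by apply: gid.
apply/permP => -[b i]; rewrite !permM !reflE //=.
have [->|iv] := eqVneq i v.2.
  rewrite tpermL (gsop v (b, v.2)) //= eqxx tpermL gj /= ?andbT.
  by case: (v.1) (b) (g v).1 => -[] [].
have [->|ij] := eqVneq i j.
  rewrite tpermR gj /= eqxx orbT tpermR (gsop v) //= ?andbT.
  by case: (v.1) (b) (g v) => -[] [[] ?].
rewrite andbF addbF tpermD 1?eq_sym //.
have givE : (g (b, i)).2 != (g v).2.
  apply: contra iv => /eqP E.
  have /perm_inj [_ ->] : g (b, i) = g ((g (b, i)).1 (+) v.1 (+) (g v).1, v.2).
    rewrite (gsop v (_ (+) _, v.2)) //= -E; case: (g (b, i)) => c1 c2 /=; congr pair.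
    by case: (c1) (v.1) (g v).1 => -[] [].
  by [].
have gij : (g (b, i)).2 != j.
  apply: contra ij => /eqP E.
  have /perm_inj [_ ->] : g (b, i) = g ((g (b, i)).1, j).
    by rewrite gj -E; case: (g _).
  by [].
rewrite [(g v).2 == _]eq_sym (negbTE givE) (negbTE gij) andbF addbF tpermD 1?eq_sym //.
by case: (g _).
Qed.

Lemma conj_xi n k (g : {perm signed n}) (j : 'I_n) :
  g \in hyp_fix n k -> (k <= j)%N -> (xi j * g)%g = (g * xi j)%g.
Proof.
move=> gk kj; have [_ gid] := hyp_fixP _ _ gk.
apply/permP => x; rewrite !permM !xiE; have [xj|xj] := eqVneq x.2 j.
  by rewrite !gid /= ?xj ?eqxx.
rewrite addbF -surjective_pairing; have [gxj|gxj] := eqVneq (g x).2 j.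
  have /perm_inj E : g (g x) = g x by rewrite gid // gxj.
  by rewrite -gxj E eqxx in xj.
by rewrite addbF -surjective_pairing.
Qed.

Lemma xi_refl n (v : signed n) (j : 'I_n) :
  v.2 != j -> (xi j * refl v j)%g = (refl (sopp v) j * xi j)%g.
Proof.
move=> vj; apply/permP => -[b i]; rewrite !permM !(xiE, reflE) //=.
case: v vj => [c k] /= kj; case: tpermP => [->|->|/eqP ik /eqP ij]; last first.
- by rewrite (negbTE ik) (negbTE ij) !andbF !addbF.
- by rewrite eqxx orbT (negbTE kj) !andbT addbF; case: (b) (c) => -[].
- by rewrite (negbTE kj) !eqxx !andbT addbF; case: (b) (c) => -[].
Qed.

Lemma xi_xi n (j : 'I_n) : (xi j * xi j)%g = 1%g.
Proof. exact: tperm2. Qed.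

Lemma xi_fix n (j : 'I_n) : xi j \in hyp_fix n j.+1.
Proof.
have := xi_hyperoct j; rewrite inE => /forallP h.
apply/hyp_fixP; split=> x; first exact/eqP.
by rewrite xiE; case: x => b i /= ij; case: eqVneq ij => [->|]; rewrite ?ltnn ?addbF.
Qed.

Section Consecutive.
Variables (n : nat) (i j : 'I_n).
Hypothesis ij : j = i.+1 :> nat.

Let neq_ij : i != j.
Proof. by rewrite -(inj_eq val_inj) /= ij neq_ltn ltnSn. Qed.

Lemma transp_transp : (transp i j * transp i j)%g = 1%g.
Proof. by apply/permP => -[b k]; rewrite permM !transpE perm1 /= tpermK. Qed.

Lemma transp_notin : transp i j \notin hyp_fix n j.
Proof.
apply/negP => /hyp_fixP[_ /(_ (false, j) (leqnn j))]; rewrite transpE /= tpermR.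
by move/(congr1 snd) => /= E; case/eqP: neq_ij.
Qed.

(** B_j meets its conjugate by the transposition in B_i: if the conjugate fixes [j], the element
    itself fixes [i]. *)
Lemma conj_transp_fix (g : {perm signed n}) : g \in hyp_fix n j ->
  (transp i j * g * transp i j)%g \in hyp_fix n j -> g \in hyp_fix n i.
Proof.
move=> gj sgs; have [go gid] := hyp_fixP _ _ gj; have [_ sid] := hyp_fixP _ _ sgs.
apply/hyp_fixP; split=> // -[b k] /=; rewrite leq_eqVlt => /predU1P[/val_inj<-|ik].
  have sj : transp i j (b, j) = (b, i) by rewrite transpE /= tpermR.
  have := sid (b, j) (leqnn j); rewrite !permM sj => E.
  by apply: (@perm_inj _ (transp i j)); rewrite E transpE /= tpermL.
by apply: gid; rewrite /= ij.
Qed.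

Lemma transp_comm (g : {perm signed n}) : g \in hyp_fix n i ->
  (transp i j * g)%g = (g * transp i j)%g.
Proof.
move=> gi; have [_ gid] := hyp_fixP _ _ gi; apply/permP => x; rewrite !permM.
have tD (k : 'I_n) : (k < i)%N -> tperm i j k = k.
  by move=> ki; rewrite tpermD // -(inj_eq val_inj) /= ?ij; lia.
have [xi|ix] := ltnP x.2 i.
  by rewrite !transpE !tD ?hyp_fix_lt // -!surjective_pairing.
rewrite [in RHS]gid // gid // transpE /=.
by case: tpermP => [_|_|_ _]; rewrite ?ij.
Qed.

Lemma conj_transp_refl (v : signed n) : (v.2 < i)%N ->
  (transp i j * refl v i * transp i j)%g = refl v j.
Proof.
move=> vi; have vi' : v.2 != i by rewrite neq_ltn vi.
have vj : v.2 != j by rewrite -(inj_eq val_inj) /= ij neq_ltn ltnS (ltnW vi).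
apply/permP => -[b k]; rewrite !permM !(transpE, reflE) //=; congr pair; last first.
  have := tpermJ v.2 i (tperm i j); rewrite tpermL [tperm i j v.2]tpermD 1?eq_sym //.
  by move <-; rewrite !permM tpermV.
rewrite !(can2_eq (tpermK i j) (tpermK i j)) tpermL.
by rewrite tpermD // eq_sym.
Qed.

Lemma conj_transp_xi : (transp i j * xi i * transp i j)%g = xi j.
Proof.
apply/permP => -[b k]; rewrite !permM !(transpE, xiE) /= tpermK; congr pair.
by rewrite (can2_eq (tpermK i j) (tpermK i j)) tpermL.
Qed.

End Consecutive.

(** * Jucys-Murphy elements and sign projectors *)

Section JucysMurphy.
Variables (R : numFieldType) (n : nat).
Notation alg := (galg R {perm signed n}).
Notation delta := (@gdelta R {perm signed n}).
Implicit Types (a b : alg) (i j : 'I_n) (e : bool).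

Definition jm j : alg := 2^-1 *: \sum_(v : signed n | (v.2 < j)%N) delta (refl v j).

(** The idempotent of the eigenvalue (-1)^e of [xi j]; [false] will correspond to the first
    diagram. *)
Definition pr j e : alg := 2^-1 *: (1 + (-1) ^+ e *: delta (xi j)).

Let nz2 : 2 != 0 :> R. Proof. by rewrite pnatr_eq0. Qed.

Lemma jm_comm k j a : supp (hyp_fix n k) a -> (k <= j)%N -> GRing.comm a (jm j).
Proof.
move=> sa kj; apply: (supp_comm sa) => g gk.
rewrite /GRing.comm /jm -scalerAr -scalerAl; congr (_ *: _).
have gj := subsetP (hyp_fix_sub n kj) _ gk.
rewrite mulr_sumr mulr_suml (reindex_inj (@perm_inj _ g)) /=.
rewrite (eq_bigl (fun v : signed n => v.2 < j)%N); last first.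
  by move=> v; rewrite (hyp_fix_lt _ gj).
by apply: eq_bigr => v vj; rewrite !gdeltaM (conj_refl gj).
Qed.

Lemma pr_comm k j e a : supp (hyp_fix n k) a -> (k <= j)%N -> GRing.comm a (pr j e).
Proof.
move=> sa kj; apply: (supp_comm sa) => g gk.
rewrite /GRing.comm /pr -scalerAr -scalerAl mulrDr mulrDl mulr1 mul1r.
by rewrite -scalerAr -scalerAl !gdeltaM (conj_xi gk).
Qed.

Lemma xi_jm j : delta (xi j) * jm j = jm j * delta (xi j).
Proof.
rewrite /jm -scalerAr -scalerAl; congr (_ *: _).
have soppK : involutive (@sopp n) by case=> b i; rewrite /sopp /= negbK.
rewrite mulr_sumr mulr_suml [RHS](reindex_inj (inv_inj soppK)) /=.
apply: eq_bigr => v vj; rewrite !gdeltaM xi_refl //.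
by rewrite -(inj_eq val_inj) neq_ltn vj.
Qed.

Lemma pr_jm j e : GRing.comm (pr j e) (jm j).
Proof.
rewrite /GRing.comm /pr -[LHS]scalerAl -[RHS]scalerAr mulrDr mulrDl mulr1 mul1r.
by rewrite -scalerAl -[in RHS]scalerAr xi_jm.
Qed.

Lemma pr_mul j e e' : pr j e * pr j e' = if e == e' then pr j e else 0.
Proof.
have xx : delta (xi j) * delta (xi j) = 1 by rewrite gdeltaM xi_xi.
rewrite /pr -scalerAl -scalerAr scalerA mulrDl mul1r mulrDr mulr1.
rewrite -scalerAl -scalerAr xx scalerA.
case: e e' => [] [] /=; rewrite ?expr0 ?expr1 ?mulN1r ?mulrN1 ?opprK ?mul1r
  ?scaleN1r ?scale1r.
- rewrite [- _ + 1]addrC -mulr2n -scaler_nat scalerA; congr (_ *: _).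
  by rewrite -mulrA mulVf // mulr1.
- by rewrite -opprD [_ (xi j) + 1]addrC subrr scaler0.
- by rewrite -[_ (xi j) - 1]opprB subrr scaler0.
- rewrite [_ (xi j) + 1]addrC -mulr2n -scaler_nat scalerA; congr (_ *: _).
  by rewrite -mulrA mulVf // mulr1.
Qed.

Lemma sum_pr j : pr j false + pr j true = 1.
Proof.
rewrite /pr -scalerDr expr0 expr1 scale1r scaleN1r addrACA subrr addr0.
by rewrite -mulr2n -scaler_nat scalerA mulVf // scale1r.
Qed.

Lemma supp_jm j : supp (hyp_fix n j.+1) (jm j).
Proof.
apply: suppZ; apply: supp_sum => v vj; exact/supp_gdelta/refl_fix.
Qed.

Lemma supp_pr j e : supp (hyp_fix n j.+1) (pr j e).
Proof.
apply/suppZ/suppD; first exact: supp1.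
exact/suppZ/supp_gdelta/xi_fix.
Qed.

Lemma restr_pr j e : restr (hyp_fix n j) (pr j e) = 2^-1 *: 1.
Proof.
rewrite /pr restrZ restrD (restr_id (@supp1 _ _ _)) restrZ.
have -> : restr (hyp_fix n j) (delta (xi j)) = 0.
  apply/ffunP => g; rewrite !ffunE; case: ifP => // gj; case: eqP => // gx.
  have [_ /(_ (false, j) (leqnn _))] := hyp_fixP _ _ gj.
  by rewrite gx xiE /= eqxx.
by rewrite scaler0 addr0.
Qed.

(** Every group element in the expansion moves [j], hence lies outside B_j. This is the counterpart
    of the mean content being zero. *)
Lemma restr_pr_jm j e : restr (hyp_fix n j) (pr j e * jm j) = 0.
Proof.
apply/ffunP => g; rewrite ffunE [RHS]ffunE; case: ifP => // gj.
have [_ gid] := hyp_fixP _ _ gj.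
rewrite /pr /jm -scalerAl -scalerAr scalerA galg_scaleE mulrDl mul1r -scalerAl.
rewrite mulr_sumr ffunE galg_scaleE !sum_ffunE !big1 ?mulr0 ?addr0 ?mulr0 //= => v vj.
  rewrite gdeltaM ffunE; case: eqP => // gE; have := gid (false, j) (leqnn _).
  have vj' : v.2 != j by rewrite -(inj_eq val_inj) neq_ltn vj.
  rewrite gE permM xiE reflE //= eqxx tpermR => /(congr1 snd) /= E.
  by rewrite E eqxx in vj'.
rewrite ffunE; case: eqP => // gE; have := gid (false, j) (leqnn _).
have vj' : v.2 != j by rewrite -(inj_eq val_inj) neq_ltn vj.
rewrite gE reflE //= tpermR => /(congr1 snd) /= E.
by rewrite E eqxx in vj'.
Qed.

Section Consecutive.
Variables (i j : 'I_n).
Hypothesis ij : j = i.+1 :> nat.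

Let s : alg := delta (transp i j).
Let x : alg := jm i.
Let y : alg := jm j.
(** The projector on equal signs at [i] and [j], that is (1 + xi_i xi_j) / 2. *)
Definition agree : alg := pr i false * pr j false + pr i true * pr j true.

(** Conjugation by [s] carries the reflections at [i] to the reflections at [j] with [v.2 < i]; the
    two left over, (i j) and xi_i xi_j (i j), sum to twice [s * agree]. *)
Lemma jm_consecutive : y = s * x * s + s * agree.
Proof.
have neq_ij : i != j by rewrite -(inj_eq val_inj) /= ij neq_ltn ltnSn.
have -> : agree = 2^-1 *: (1 + delta (xi j * xi i)%g).
  rewrite /agree /pr -!scalerAl -!scalerAr -!scalerDr scalerA.
  rewrite !mulrDl !mulrDr !mul1r !mulr1 -!scalerAl -!scalerAr !scalerA !expr0 !expr1.
  rewrite !mul1r mulN1r opprK !scale1r !scaleN1r gdeltaM.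
  have -> : (xi i * xi j)%g = (xi j * xi i)%g.
    by apply/esym/(@conj_xi _ i.+1); [apply: xi_fix | rewrite ij].
  rewrite (AC ((2*2)*(2*2)) ((1*4)*(5*8)*(2*6)*(3*7))) /= !subrr !addr0 -mulr2n.
  by rewrite -scaler_nat scalerA -mulrA mulVf // mulr1.
rewrite /y /x /jm -!scalerAr -scalerAl -scalerDr; congr (_ *: _).
rewrite mulr_sumr mulr_suml mulrDr mulr1 gdeltaM mulgA.
rewrite (bigID (fun v : signed n => v.2 < i)%N) /=; congr (_ + _).
  rewrite (eq_bigl (fun v : signed n => v.2 < i)%N); last first.
    by move=> v; rewrite ij ltnS andb_idl // => /ltnW.
  by apply: eq_bigr => v vi; rewrite !gdeltaM conj_transp_refl.
rewrite (bigD1 (false, i)) ?ij ?ltnn ?ltnSn //= (bigD1 (true, i)) ?ij ?ltnn ?ltnSn //=.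
rewrite big1 ?addr0 // => -[b k] /=; rewrite ltnS -ltnNge.
case/andP=> /andP[/andP[ki ik] kf] kt.
have ki' : k = i by apply/val_inj/eqP; rewrite eqn_leq ki.
by move: kf kt; rewrite ki' !xpair_eqE eqxx !andbT; case: (b).
Qed.

Lemma restr_transp_mul a : supp (hyp_fix n j) a -> restr (hyp_fix n j) (s * a) = 0.
Proof.
move=> sa; apply/ffunP => g; rewrite restrE [RHS]ffunE; case: ifP => // gj.
rewrite gdelta_mulE sa // groupMr // groupV; exact: transp_notin.
Qed.

(** For g in B_j the left side is a (s g s), zero unless s g s lies in B_j too; then g is in B_i and
    commutes with [s]. *)
Lemma restr_conj_transp a : supp (hyp_fix n j) a ->
  restr (hyp_fix n j) (s * a * s) = restr (hyp_fix n i) a.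
Proof.
have sV : (transp i j)^-1%g = transp i j.
  by apply/eqP; rewrite eq_invg_mul transp_transp.
move=> sa; apply/ffunP => g; rewrite !restrE mul_gdeltaE gdelta_mulE sV.
rewrite mulgA; case: ifP => gj; case: ifP => gi //.
- by rewrite -mulgA -(transp_comm ij gi) mulgA transp_transp mul1g.
- apply: sa; apply/negP => sgs.
  by rewrite (conj_transp_fix ij gj sgs) in gi.
- have ij' : (i <= j)%N by rewrite ij.
  by rewrite (subsetP (hyp_fix_sub n ij') _ gi) in gj.
Qed.

Lemma restr_moment_rec e k :
  restr (hyp_fix n i) (pr i e * x ^+ k.+2)
    - x * restr (hyp_fix n i) (pr i e * x ^+ k.+1) *+ 2
    + x ^+ 2 * restr (hyp_fix n i) (pr i e * x ^+ k) =
  restr (hyp_fix n j) (pr j e * y ^+ k.+2)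
    - x * restr (hyp_fix n j) (pr j e * y ^+ k.+1) *+ 2
    + x ^+ 2 * restr (hyp_fix n j) (pr j e * y ^+ k)
    - pr i e * restr (hyp_fix n j) (pr j e * y ^+ k).
Proof.
have sx : supp (hyp_fix n j) x by rewrite ij; apply: supp_jm.
have sp e' : supp (hyp_fix n j) (pr i e') by rewrite ij; apply: supp_pr.
have ss : s * s = 1 by rewrite gdeltaM transp_transp.
have sps e' : s * pr i e' * s = pr j e'.
  rewrite /pr -scalerAr -scalerAl mulrDr mulrDl mulr1 ss -scalerAr -scalerAl.
  by rewrite !gdeltaM conj_transp_xi.
have sc m : supp (hyp_fix n j) (pr i e * x ^+ m) by apply/suppM/suppX/sx/sp.
rewrite -(restr_conj_transp (sc k)) -(restr_conj_transp (sc k.+1)).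
rewrite -(restr_conj_transp (sc k.+2)).
have xy : GRing.comm x y by apply: (jm_comm sx).
have pq e1 e2 : GRing.comm (pr i e1) (pr j e2) by apply: (pr_comm _ (sp e1)).
have xq e' : GRing.comm x (pr j e') by apply: (pr_comm _ sx).
apply: (expectation_rec ss sps xy pq (pr_jm i) xq (pr_mul i) (pr_mul j)
  (erefl agree) jm_consecutive (E := restr (hyp_fix n j))
  (S := supp (hyp_fix n j))) => //.
- exact: supp1.
- by move=> a b; apply: suppM.
- by move=> a b; apply: restrM.
- exact: restr_transp_mul.
Qed.

End Consecutive.
End JucysMurphy.

(** * Joint spectrum of the commuting elements under the trace *)

Section GelfandZetlin.
Variables (R : numFieldType) (n : nat).
Notation alg := (galg R {perm signed n}).
Notation word := (seq (step n)).
Implicit Types (a b : alg) (i j : 'I_n) (e : bool) (phi psi : word -> R).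

Definition step_fun e m phi (u : word) : R :=
  if u is (e', r) :: u' then
    (e' == e)%:R * phi u' * cont R (beta (rows u' e')) r ^+ m
  else 0.

(* [GZ k a phi]: [a] belongs to the algebra generated by the first [k] of the
   [pr] and [jm], and [phi] is a function on words of length [k] that should be
   its joint spectrum.  The relation may a priori be multivalued, which is
   harmless: [trace_GZ] holds for each such [phi]. *)
Inductive GZ : nat -> alg -> (word -> R) -> Prop :=
| GZ_scalar c : GZ 0 (c *: 1) (fun=> c)
| GZ_step j a phi e m : GZ j a phi ->
    GZ j.+1 (a * pr R j e * jm R j ^+ m) (step_fun e m phi)
| GZ_add k a b phi psi : GZ k a phi -> GZ k b psi ->
    GZ k (a + b) (fun u => phi u + psi u)
| GZ_ext k a phi psi : GZ k a phi -> {in vwords n k, phi =1 psi} -> GZ k a psi.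

Lemma GZ_supp k a phi : GZ k a phi -> supp (hyp_fix n k) a.
Proof.
elim=> {k a phi} [c|j a phi e m _ sa|k a b phi psi _ sa _ sb|//].
- exact/suppZ/supp1.
- apply: suppM; last exact/suppX/supp_jm.
  apply: suppM; last exact: supp_pr.
  by move=> g gj; apply: sa; apply: contra gj; apply/subsetP/hyp_fix_sub.
- exact: suppD.
Qed.

Lemma GZ_scale k a phi c : GZ k a phi -> GZ k (c *: a) (fun u => c * phi u).
Proof.
elim=> {k a phi} [d|j a phi e m _ IH|k a b phi psi _ IHa _ IHb|k a phi psi _ IH pp].
- by rewrite scalerA; apply: GZ_scalar.
- rewrite scalerAl scalerAl; apply: (GZ_ext (GZ_step e m IH)) => -[|[e' r] u] _ /=.
    by rewrite mulr0.
  by ring.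
- by rewrite scalerDr; apply: (GZ_ext (GZ_add IHa IHb)) => u _; rewrite mulrDr.
- by apply: (GZ_ext IH) => u uk; rewrite pp.
Qed.

(** [pr R j e] and [jm R j] commute with everything of level [j], so exponents add; orthogonality of
    the two projectors matches that of the indicators in [step_fun]. *)
Lemma GZ_mul k a b phi psi : GZ k a phi -> GZ k b psi ->
  GZ k (a * b) (fun u => phi u * psi u).
Proof.
move=> Ha; elim: Ha b psi => {k a phi}
  [c|j a phi e m Ha IH|k a b phi psi _ IHa _ IHb|k a phi psi _ IH pp] b' psi' Hb.
- by rewrite -scalerAl mul1r; apply: GZ_scale.
- move Ek: j.+1 Hb => k Hb; elim: Hb Ek => {k b' psi'}
    [//|j' b psi e' m' Hb _|k b b' psi psi' _ IH1 _ IH2|k b psi psi' _ IH1 pp] Ek.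
  + case: Ek => /val_inj jj; rewrite -{j'}jj in Hb *.
    have sb := GZ_supp Hb.
    have -> : a * pr R j e * jm R j ^+ m * (b * pr R j e' * jm R j ^+ m') =
        a * b * (pr R j e * pr R j e') * jm R j ^+ (m + m').
      rewrite exprD !mulrA; congr (_ * _).
      rewrite -[a * pr R j e * _ * b]mulrA -(commrX m (jm_comm sb (leqnn j))).
      rewrite !mulrA -[a * pr R j e * b]mulrA -(pr_comm e sb (leqnn j)) mulrA.
      by rewrite -!mulrA (commrX m (pr_jm R j e')).
    rewrite pr_mul; case: (eqVneq e e') => [<-|ee'].
      apply: (GZ_ext (GZ_step e (m + m') (IH _ _ Hb))) => -[|[e0 r] u] _ /=.
        by rewrite mulr0.
      by rewrite exprD; case: (e0 == e); rewrite /=; ring.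
    (* The zero product is presented as 0 times an element of level [j.+1], since scalars are
       constructors at level 0 only. *)
    rewrite mulr0 mul0r -(scale0r (a * pr R j e * jm R j ^+ m)).
    apply: (GZ_ext (GZ_scale 0 (GZ_step e m Ha))) => -[|[e0 r] u] _ /=.
      by rewrite !mulr0.
    case: (eqVneq e0 e) => [->|_]; last by rewrite /=; ring.
    by rewrite (negbTE ee') /=; ring.
  + rewrite mulrDr; apply: (GZ_ext (GZ_add (IH1 Ek) (IH2 Ek))) => u _.
    by rewrite mulrDr.
  + by apply: (GZ_ext (IH1 Ek)) => u uk; rewrite pp.
- rewrite mulrDl; apply: (GZ_ext (GZ_add (IHa _ _ Hb) (IHb _ _ Hb))) => u _.
  by rewrite mulrDl.
- by apply: (GZ_ext (IH _ _ Hb)) => u uk; rewrite pp.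
Qed.

Lemma GZ_opp k a phi : GZ k a phi -> GZ k (- a) (fun u => - phi u).
Proof.
move=> /(GZ_scale (-1)); rewrite scaleN1r => Ha.
by apply: (GZ_ext Ha) => u _; rewrite mulN1r.
Qed.

Lemma GZ_sub k a b phi psi : GZ k a phi -> GZ k b psi ->
  GZ k (a - b) (fun u => phi u - psi u).
Proof. by move=> Ha /GZ_opp; apply: GZ_add. Qed.

(** Writing 1 as the sum of the two projectors raises the level; on words the last box is then
    ignored. *)
Lemma GZ_lift j a phi : GZ j a phi -> GZ j.+1 a (fun u => phi (behead u)).
Proof.
move=> Ha; have := GZ_add (GZ_step false 0 Ha) (GZ_step true 0 Ha).
rewrite !expr0 !mulr1 -mulrDr sum_pr mulr1 => H; apply: (GZ_ext H).
move=> u /size_vwords; case: u => // -[e r] u _ /=.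
by case: e; rewrite /= ?expr0; ring.
Qed.

Lemma GZ_const k c : (k <= n)%N -> GZ k (c *: 1) (fun=> c).
Proof.
elim: k => [|k IH] kn; first exact: GZ_scalar.
by have := GZ_lift (j := Ordinal kn) (IH (ltnW kn)).
Qed.

Lemma GZ_exp k a phi m : (k <= n)%N -> GZ k a phi ->
  GZ k (a ^+ m) (fun u => phi u ^+ m).
Proof.
move=> kn Ha; elim: m => [|m IH].
  by rewrite expr0 -[1]scale1r; apply: (GZ_ext (GZ_const 1 kn)) => u _; rewrite expr0.
by rewrite exprS; apply: (GZ_ext (GZ_mul Ha IH)) => u _; rewrite exprS.
Qed.

Definition last_cont (u : word) : R :=
  if u is (e, r) :: u' then cont R (beta (rows u' e)) r else 0.
Definition last_sign (u : word) e : R :=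
  if u is (e', r) :: u' then (e' == e)%:R else 0.

Lemma GZ_pr_jm j e m :
  GZ j.+1 (pr R j e * jm R j ^+ m) (fun u => last_sign u e * last_cont u ^+ m).
Proof.
have := GZ_step e m (GZ_const 1 (ltnW (ltn_ord j))); rewrite scale1r mul1r => H.
apply: (GZ_ext H) => u /size_vwords; case: u => // -[e' r] u _ /=.
by rewrite mulr1.
Qed.

Lemma GZ_jm j m : GZ j.+1 (jm R j ^+ m) (fun u => last_cont u ^+ m).
Proof.
have := GZ_add (GZ_pr_jm j false m) (GZ_pr_jm j true m).
rewrite -mulrDl sum_pr mul1r => H; apply: (GZ_ext H) => u /size_vwords.
by case: u => // -[[] r] u _ /=; rewrite ?mul1r ?mul0r ?add0r ?addr0.
Qed.

Lemma GZ_mulrn k a phi m : GZ k a phi -> GZ k (a *+ m) (fun u => phi u *+ m).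
Proof.
move=> Ha; rewrite -scaler_nat; apply: (GZ_ext (GZ_scale m%:R Ha)) => u _.
by rewrite mulr_natl.
Qed.

Lemma GZ_restr_pr j e :
  GZ j (restr (hyp_fix n j) (pr R j e)) (fun u => moment R (beta (rows u e)) 0 / 2).
Proof.
rewrite restr_pr; apply: (GZ_ext (GZ_const _ (ltnW (ltn_ord j)))) => u uk.
by rewrite (moment0_vwords R e uk) // mul1r.
Qed.

(** [moment_rec] solved for the top moment, in the form of [restr_moment_rec]. For the diagram that
    does not receive the box the moments are unchanged and the corrections cancel. *)
Lemma moment_cons k u e e' r m : (e', r) :: u \in vwords n k ->
  let x := cont R (beta (rows u e')) r in
  let M l := moment R (beta (rows l e)) in
  M ((e', r) :: u) m.+2 / 2 =
  M u m.+2 / 2 - x * (M u m.+1 / 2) *+ 2 + x ^+ 2 * (M u m / 2)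
  + x * (M ((e', r) :: u) m.+1 / 2) *+ 2 - x ^+ 2 * (M ((e', r) :: u) m / 2)
  + (e' == e)%:R * (M ((e', r) :: u) m / 2).
Proof.
move=> uk x M; have inj := beta_inj (part_vwords e uk).
have ME t : M ((e', r) :: u) t =
    moment R (if e == e' then incr (beta (rows u e')) r else beta (rows u e)) t.
  by apply: eq_moment; apply: beta_rows_cons.
case: (eqVneq e e') => [E0|ee']; rewrite !{}ME; last first.
  by rewrite (negbTE ee') /M /=; ring.
subst e'; rewrite eqxx; have li : injective (incr (beta (rows u e)) r).
  move=> i1 i2; have := beta_rows_cons e r u e; rewrite eqxx => B.
  by rewrite -!B => /inj.
have E := moment_rec R m li; rewrite /= -/x in E.
rewrite /= mul1r.
have -> : moment R (incr (beta (rows u e)) r) m.+2 = M u m.+2 - 2 * x * M u m.+1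
    + x ^+ 2 * M u m + 2 * x * moment R (incr (beta (rows u e)) r) m.+1
    - (x ^+ 2 - 1) * moment R (incr (beta (rows u e)) r) m.
  by rewrite -E; ring.
by field.
Qed.

(** By induction on the index: [restr_moment_rec] expresses each moment through lower ones, those of
    the previous index and elements of level [j], while [moment_cons] gives the same relation for
    the functions on words. *)
Lemma GZ_moment j e m :
  GZ j (restr (hyp_fix n j) (pr R j e * jm R j ^+ m))
    (fun u => moment R (beta (rows u e)) m / 2).
Proof.
case: j => k; elim: k e m => [|k IH] e m kn.
  have j0 : jm R (Ordinal kn) = 0.
    by rewrite /jm big_pred0 ?scaler0 // => v; rewrite ltn0.
  case: m => [|m]; first by rewrite expr0 mulr1; apply: GZ_restr_pr.
  rewrite exprS j0 mul0r mulr0 raddf0 -(scale0r 1); apply: (GZ_ext (GZ_scalar 0)).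
  by move=> u; rewrite inE => /eqP->; rewrite moment_nil mul0r.
have kn' : (k < n)%N := ltnW kn.
pose i := Ordinal kn'; set j := Ordinal kn; have ij : j = i.+1 :> nat by [].
(* The recurrence has order two, so two consecutive moments are carried along. *)
suff: GZ j (restr (hyp_fix n j) (pr R j e * jm R j ^+ m))
        (fun u => moment R (beta (rows u e)) m / 2) /\
      GZ j (restr (hyp_fix n j) (pr R j e * jm R j ^+ m.+1))
        (fun u => moment R (beta (rows u e)) m.+1 / 2) by case.
elim: m => [|m [IH1 IH2]].
  split; first by rewrite expr0 mulr1; apply: GZ_restr_pr.
  rewrite expr1 restr_pr_jm -(scale0r 1).
  apply: (GZ_ext (GZ_const _ (ltnW (ltn_ord j)))) => u uk.
  by rewrite (moment1_vwords R e uk) // mul0r.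
split=> //.
have X1 := GZ_jm i 1; have X2 := GZ_jm i 2; have P := GZ_pr_jm i e 0.
rewrite expr1 in X1; rewrite expr0 mulr1 in P.
have U t := GZ_lift (IH e t kn' : GZ i _ _).
(* The recurrence solved for the moment of order [m.+2], assembled term by term. *)
have H := GZ_add (GZ_sub (GZ_add (GZ_add (GZ_sub (U m.+2)
  (GZ_mulrn 2 (GZ_mul X1 (U m.+1)))) (GZ_mul X2 (U m)))
  (GZ_mulrn 2 (GZ_mul X1 IH2))) (GZ_mul X2 IH1)) (GZ_mul P IH1).
rewrite (restr_moment_rec R ij) in H.
move: H; set Y2 := restr _ (_ * _ ^+ m.+2).
rewrite [X in GZ _ X](_ : _ = Y2); last first.
  have shuffle (y a b c : alg) : y - a + b - c + a - b + c = y.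
    by rewrite (AC 7 (1*(5*2)*(3*6)*(7*4))) /= !subrr !addr0.
  exact: shuffle.
move=> H; apply: (GZ_ext H) => u uk.
have := size_vwords uk; case: u uk => // -[e' r] u uk _.
by rewrite (moment_cons _ _ uk) /= !expr1 expr0 mulr1.
Qed.

(** The expectation onto B_j preserves the value at 1 and turns the top generator into half a
    moment, an average over rows with weights [rho]; this extends [prob] by one step. *)
Lemma trace_GZ k a phi : (k <= n)%N -> GZ k a phi ->
  a 1%g = \sum_(u <- vwords n k) prob R u * phi u.
Proof.
elim: k a phi => [|k IH] a phi kn Ha.
  move: (erefl 0%N) Ha; move: {1 3}0%N => k k0 Ha.
  elim: Ha k0 => {k a phi}
    [c|//|k a b phi psi _ IHa _ IHb|k a phi psi _ IH pp] k0.
  - by rewrite /= big_seq1 mul1r galg_scaleE galg1E ffunE eqxx mulr1.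
  - by rewrite ffunE IHa // IHb // -big_split; apply: eq_bigr => u _; rewrite mulrDr.
  - by rewrite IH //; apply: eq_big_seq => u uk; rewrite pp // k0.
move: (erefl k.+1) Ha; move: {1 3}k.+1 => k' k0 Ha.
elim: Ha k0 => {k' a phi}
    [//|j a phi e m Ha _|k' a b phi psi _ IHa _ IHb|k' a phi psi _ IHp pp] k0.
- case: k0 => kj; rewrite -[LHS](restr_at1 (hyp_fix_group n j)) -mulrA.
  rewrite restrM; last exact: (GZ_supp Ha).
  have Hm := GZ_mul Ha (GZ_moment j e m); rewrite kj in Hm *.
  rewrite (IH _ _ (ltnW kn) Hm) big_vwordsS; apply: eq_big_seq => u uk /=.
  rewrite big_mkcond /=.
  (* The sum is extended to all steps: those not addable have [rho] zero. *)
  pose F e0 r := (e0 == e)%:R *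
    (prob R u * phi u / 2 *
      (rho R (beta (rows u e0)) r * cont R (beta (rows u e0)) r ^+ m)).
  transitivity (\sum_(st : step n) F st.1 st.2).
    rewrite -(pair_bigA _ F) /= (bigD1 e) //= [X in _ + X]big1 => [|e0 /negbTE ee0].
      rewrite addr0 /F eqxx -mulr_sumr mul1r -mulr_sumr -/(moment _ _ _).
      by ring.
    by rewrite big1 // => r _; rewrite /F ee0 mul0r.
  apply: eq_bigr => -[e0 r] _; rewrite /F; case: ifPn => [_|nad].
    by ring.
  by rewrite rho_not_addable ?(part_vwords _ uk) // mul0r !mulr0.
- by rewrite ffunE IHa // IHb // -big_split; apply: eq_bigr => u _; rewrite mulrDr.
- by rewrite IHp //; apply: eq_big_seq => u uk; rewrite pp // k0.
Qed.

End GelfandZetlin.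

(** * Standard bitableaux as growth words *)

Section Prefixes.
Variable n : nat.
Implicit Types (f : 'I_n -> step n) (u : seq (step n)).

(** The history [f] sends the entry i + 1 to the diagram and row [f i]; reversal puts the latest
    step at the head. *)
Definition wprefix f k : seq (step n) :=
  [seq f i | i <- rev [seq i : 'I_n <- enum 'I_n | (i < k)%N]].

Lemma wprefix0 f : wprefix f 0 = [::].
Proof. by rewrite /wprefix (eq_filter (a2 := pred0)) ?filter_pred0. Qed.

Lemma wprefixS f (k : 'I_n) : wprefix f k.+1 = f k :: wprefix f k.
Proof.
rewrite /wprefix -map_cons -rev_rcons; congr (map _ (rev _)).
have E m : (m <= n)%N -> map val [seq i : 'I_n <- enum 'I_n | (i < m)%N] = iota 0 m.
  move=> mn; rewrite -[LHS]/(map val (filter (preim val (fun i => i < m)%N) _)).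
  by rewrite -filter_map val_enum_ord; apply: (@filter_iota_ltn 0).
apply: (inj_map val_inj); rewrite map_rcons !E // 1?ltnW //.
by rewrite -cats1 -addn1 iotaD.
Qed.

Lemma rows_wprefix f k e r :
  rows (wprefix f k) e r = #|[set i : 'I_n | (i < k)%N && (f i == (e, r))]|.
Proof.
rewrite /rows /wprefix map_rev count_rev count_map count_filter.
rewrite cardE [in RHS]/enum_mem size_filter enumT; apply: eq_count => i /=.
by rewrite !inE andbC.
Qed.

Lemma mem_wprefix_vwords f k : (k <= n)%N ->
  (forall m e, (m <= k)%N -> part (rows (wprefix f m) e)) -> wprefix f k \in vwords n k.
Proof.
elim: k => [|k IH] kn h; first by rewrite wprefix0 inE.
have kn1 : (k < n)%N by [].
rewrite (wprefixS f (Ordinal kn1)); apply: mem_vwordsS; last first.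
  by rewrite /addable -wprefixS; apply: h.
by apply: IH => [|m e mk]; rewrite ?(ltnW kn) // h // ltnW.
Qed.

Lemma vwordsS_inv k (st : step n) u : st :: u \in vwords n k.+1 -> u \in vwords n k.
Proof. by case/flattenP => _ /mapP[v vk ->] /mapP[st' _ [_ ->]]. Qed.

Lemma vwords_wprefix f k m : (m <= k)%N -> (k <= n)%N ->
  wprefix f k \in vwords n k -> wprefix f m \in vwords n m.
Proof.
elim: k => [|k IH]; first by rewrite leqn0 => /eqP->.
rewrite leq_eqVlt => /predU1P[-> //|mk] kn.
rewrite (wprefixS f (Ordinal kn)) => /vwordsS_inv; apply: IH => //; exact: ltnW.
Qed.

Lemma wprefix_surj u : (0 < n)%N -> size u = n -> exists f, u = wprefix f n.
Proof.
move=> n0 un; pose x0 : step n := (false, Ordinal n0).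
exists (fun i => nth x0 (rev u) i).
rewrite /wprefix (eq_filter (a2 := predT)) => [|i]; last exact: ltn_ord.
rewrite filter_predT map_rev -[LHS]revK; congr rev.
rewrite (map_comp (nth x0 (rev u)) val) val_enum_ord -[RHS]/(mkseq _ n).
by rewrite -[X in mkseq _ X]un -(size_rev u) mkseq_nth.
Qed.

Lemma wprefix_inj f f' : wprefix f n = wprefix f' n -> f =1 f'.
Proof.
rewrite /wprefix (eq_filter (a2 := predT)) => [|i]; last exact: ltn_ord.
rewrite filter_predT !map_rev => /(can_inj revK) /eq_in_map h i.
by apply: h; rewrite mem_enum.
Qed.

Lemma uniq_vwords k : uniq (vwords n k).
Proof.
elim: k => //= k IH; apply: allpairs_uniq_dep => // [u _|]; first exact: enum_uniq.
by move=> [u st] [u' st'] _ _ /= [-> ->].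
Qed.

End Prefixes.

Definition lengths n (la : row_lengths n * row_lengths n) (e : bool) (i : 'I_n) : nat :=
  if e then la.2 i else la.1 i.

Section Tableaux.
Variables (n : nat) (la : row_lengths n * row_lengths n).
Hypothesis la_bip : la \in bipartitions n.
Notation box := (boxes la.1 + boxes la.2)%type.
Implicit Types (b c : box) (T : filling la).

Definition box_step b : step n :=
  match b with inl x => (false, (val x).1) | inr x => (true, (val x).1) end.

Definition box_pos b : 'I_n :=
  match b with inl x => (val x).2 | inr x => (val x).2 end.

Lemma box_eq b c : box_step b = box_step c -> box_pos b = box_pos c -> b = c.
Proof.
case: b c => [[[r x] p]|[[r x] p]] [[[r' x'] p']|[[r' x'] p']] //= [] rr xx.
  by congr inl; apply: val_inj => /=; rewrite rr xx.
by congr inr; apply: val_inj => /=; rewrite rr xx.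
Qed.

Lemma box_pos_lt b : (box_pos b < lengths la (box_step b).1 (box_step b).2)%N.
Proof. by case: b => -[[r x] p]. Qed.

Lemma lengths_le e r : (lengths la e r <= n)%N.
Proof. by rewrite /lengths; case: e; rewrite -ltnS ltn_ord. Qed.

Lemma lengths_part e : part (lengths la e).
Proof.
move: la_bip; rewrite inE => /and3P[/forallP p1 /forallP p2 _].
apply/partP => i j ij; rewrite /lengths.
by case: e; [move/forallP/(_ j): (p2 i)|move/forallP/(_ j): (p1 i)]; rewrite ij.
Qed.

Lemma box_exists (st : step n) m :
  (m < lengths la st.1 st.2)%N -> {b | box_step b = st & box_pos b = m :> nat}.
Proof.
case: st => e r /= ml; have mn := leq_trans ml (lengths_le e r).
move: ml; rewrite /lengths; case: e => ml.
  by exists (inr (exist (fun b : 'I_n * 'I_n => b.2 < la.2 b.1)%N (r, Ordinal mn) ml)).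
by exists (inl (exist (fun b : 'I_n * 'I_n => b.2 < la.1 b.1)%N (r, Ordinal mn) ml)).
Qed.

Lemma card_row (st : step n) m : (m <= lengths la st.1 st.2)%N ->
  #|[set b | (box_step b == st) && (box_pos b < m)%N]| = m.
Proof.
move=> ml; have mn := leq_trans ml (lengths_le _ _).
rewrite -(@card_in_imset _ _ box_pos) => [|b c]; last first.
  by rewrite !inE => /andP[/eqP bs _] /andP[/eqP cs _]; apply: box_eq; rewrite bs cs.
transitivity #|[set i : 'I_n | (i < m)%N]|.
  congr #|pred_of_set _|; apply/setP => i; rewrite inE; apply/imsetP/idP.
    by case=> b; rewrite inE => /andP[_ bm] ->.
  move=> im; have [b bs bi] := box_exists (leq_trans im ml).
  by exists b; [rewrite inE bs eqxx bi | apply/val_inj].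
rewrite -sum1_card (eq_bigl (fun i : 'I_n => (i < m)%N)) => [|i]; last by rewrite inE.
by rewrite -(big_ord_widen n (fun=> 1%N) mn) sum1_card card_ord.
Qed.

Lemma SYTP T : reflect
  [/\ bijective T,
      forall b c, box_step b = box_step c -> (box_pos b < box_pos c)%N ->
        (T b < T c)%N &
      forall b c, (box_step b).1 = (box_step c).1 -> box_pos b = box_pos c ->
        ((box_step b).2 < (box_step c).2)%N -> (T b < T c)%N]
  (T \in SYT la).
Proof.
rewrite inE; apply: (iffP and3P) => [[/forallP Tb /forallP T1 /forallP T2]|[Tb Tr Tc]].
  split.
  - have Tb1 k : {b | T b = k & forall c, T c = k -> c = b}.
      have /eqP card1 := Tb k; case: (pickP (fun b => T b == k)) => [b /eqP bk|no].
        exists b => // c ck; have /eqP/cards1P[d dE] := card1.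
        have : b \in [set b0 | T b0 == k] by rewrite inE bk.
        have : c \in [set b0 | T b0 == k] by rewrite inE ck.
        by rewrite dE !inE => /eqP-> /eqP->.
      by move: card1; rewrite eq_card0 // => b; rewrite inE no.
    exists (fun k => s2val (Tb1 k)) => [b|k]; last exact: (s2valP (Tb1 k)).
    by apply/esym/(s2valP' (Tb1 (T b))).
  - case=> [b|b] [c|c] //= [] bc lt.
      have /andP[/implyP h _] := forallP (T1 b) c; apply: h.
      by rewrite /box_row /box_col bc eqxx ltnS.
    have /andP[/implyP h _] := forallP (T2 b) c; apply: h.
    by rewrite /box_row /box_col bc eqxx ltnS.
  - case=> [b|b] [c|c] //= _ bc lt.
      have /andP[_ /implyP h] := forallP (T1 b) c; apply: h.
      by rewrite /box_row /box_col bc eqxx ltnS.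
    have /andP[_ /implyP h] := forallP (T2 b) c; apply: h.
    by rewrite /box_row /box_col bc eqxx ltnS.
split.
- case: Tb => g gT Tg; apply/forallP => k; apply/eqP/eqP/cards1P; exists (g k).
  apply/setP => b; rewrite !inE; apply/eqP/eqP => [<-|->]; by rewrite ?gT ?Tg.
- apply/forallP => b; apply/forallP => c; rewrite /box_row /box_col !eqSS.
  apply/andP; split; apply/implyP => /andP[/eqP/val_inj E lt].
    by apply: (Tr (inl b) (inl c)) => //=; rewrite E.
  by apply: (Tc (inl b) (inl c)).
- apply/forallP => b; apply/forallP => c; rewrite /box_row /box_col !eqSS.
  apply/andP; split; apply/implyP => /andP[/eqP/val_inj E lt].
    by apply: (Tr (inr b) (inr c)) => //=; rewrite E.
  by apply: (Tc (inr b) (inr c)).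
Qed.

(** The default [(false, k)] is never reached on a standard filling, which is surjective. *)
Definition tab_steps T (k : 'I_n) : step n :=
  odflt (false, k) (omap box_step [pick b | T b == k]).

Definition tab_word T : seq (step n) := wprefix (tab_steps T) n.

Lemma tab_stepsE T b : T \in SYT la -> tab_steps T (T b) = box_step b.
Proof.
move=> /SYTP[/bij_inj Ti _ _]; rewrite /tab_steps; case: pickP => [c /eqP/Ti->//|].
by move/(_ b); rewrite eqxx.
Qed.

Lemma rows_tab T k e r : T \in SYT la ->
  rows (wprefix (tab_steps T) k) e r =
  #|[set b | (box_step b == (e, r)) && (T b < k)%N]|.
Proof.
move=> Ts; have [Tb _ _] := SYTP _ Ts; have Ti := bij_inj Tb; case: Tb => g gT Tg.
rewrite rows_wprefix -(card_imset _ Ti); congr #|pred_of_set _|.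
apply/setP => i; rewrite inE; apply/andP/imsetP => [[ik fi]|[b]].
  by exists (g i); rewrite ?inE ?Tg // ik andbT -(tab_stepsE _ Ts) Tg.
by rewrite inE => /andP[bs bk] ->; rewrite tab_stepsE.
Qed.

(** Entries increase along rows, so the boxes of its row filled before [b] are those to its left;
    the word thus remembers columns. *)
Lemma rows_tab_pos T b : T \in SYT la ->
  rows (wprefix (tab_steps T) (T b)) (box_step b).1 (box_step b).2 = box_pos b.
Proof.
move=> Ts; have [_ Tr _] := SYTP _ Ts.
rewrite rows_tab // -surjective_pairing -[RHS](card_row (ltnW (box_pos_lt b))).
congr #|pred_of_set _|; apply/setP => c; rewrite !inE; case: eqP => //= cb.
apply/idP/idP => [lt|]; last exact: Tr.
rewrite ltnNge leq_eqVlt; apply/negP => /predU1P[/val_inj E|/Tr].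
  by rewrite (box_eq cb (esym E)) ltnn in lt.
by rewrite cb => /(_ erefl) /ltnW; rewrite leqNgt lt.
Qed.

(** Above a filled box stands a box filled earlier, so the columns filled in row [j] are among those
    filled in row [i]. *)
Lemma part_rows_tab T k e : T \in SYT la -> part (rows (wprefix (tab_steps T) k) e).
Proof.
move=> Ts; have [_ Tr Tc] := SYTP _ Ts; apply/partP => i j ij; rewrite !rows_tab //.
have pos_inj r :
    {in [set b | (box_step b == (e, r)) && (T b < k)%N] &, injective box_pos}.
  move=> b c; rewrite !inE => /andP[/eqP bs _] /andP[/eqP cs _].
  by apply: box_eq; rewrite bs cs.
rewrite -!(card_in_imset (pos_inj _)); apply/subset_leq_card/subsetP => x.
case/imsetP => b; rewrite inE => /andP[/eqP bs bk] ->.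
have := box_pos_lt b; rewrite bs /= => lt.
have [c cs cp] := @box_exists (e, i) _
  (leq_trans lt (partP _ (lengths_part e) _ _ ij)).
apply/imsetP; exists c; last exact/val_inj.
rewrite inE cs eqxx /=; case: (eqVneq i j) => [E|ne].
  by rewrite (_ : c = b) //; apply: box_eq; [rewrite cs bs E|apply/val_inj].
apply: ltn_trans bk; apply: Tc; rewrite ?cs ?bs //=; first exact/val_inj.
by rewrite ltn_neqAle ij andbT.
Qed.

Lemma rows_tab_word T e r : T \in SYT la -> rows (tab_word T) e r = lengths la e r.
Proof.
move=> Ts; rewrite rows_tab // -[RHS](@card_row (e, r)) //.
congr #|pred_of_set _|; apply/setP => b; rewrite !inE; case: eqP => //= bs.
by have := box_pos_lt b; rewrite bs ltn_ord => ->.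
Qed.

Lemma tab_word_vwords T : T \in SYT la -> tab_word T \in vwords n n.
Proof. by move=> Ts; apply: mem_wprefix_vwords => // m e _; apply: part_rows_tab. Qed.

(** The word gives the diagram and row of each entry, and [rows_tab_pos] its column. *)
Lemma tab_word_inj : {in SYT la &, injective tab_word}.
Proof.
move=> T T' Ts Ts' /wprefix_inj E; apply/ffunP => b.
have [[g' gT' Tg'] _ _] := SYTP _ Ts'; pose c := g' (T b).
have Tc : T' c = T b by rewrite Tg'.
suff bc : b = c by rewrite [in RHS]bc Tc.
have bs : box_step b = box_step c.
  by rewrite -(tab_stepsE b Ts) E -Tc tab_stepsE.
apply: box_eq => //; apply/val_inj => /=.
rewrite -(rows_tab_pos b Ts) -(rows_tab_pos c Ts') Tc bs.
by rewrite !rows_wprefix; congr #|pred_of_set _|; apply/setP => i; rewrite !inE E.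
Qed.

(** The box [b] receives the time at which its row, of length [box_pos b], gets one more box. *)
Lemma tab_word_surj u : (0 < n)%N -> u \in vwords n n ->
  (forall e r, rows u e r = lengths la e r) -> exists2 T, T \in SYT la & u = tab_word T.
Proof.
move=> n0 un ul; have [f uf] := wprefix_surj n0 (size_vwords un); subst u.
pose R k (st : step n) := rows (wprefix f k) st.1 st.2.
have RS (k : 'I_n) st : R k.+1 st = (R k st + (f k == st))%N.
  by rewrite /R wprefixS /rows /= addnC -surjective_pairing.
have Rmono st : {homo R ^~ st : k k' / (k <= k')%N}.
  move=> k k' kk; rewrite /R !rows_wprefix; apply/subset_leq_card/subsetP => i.
  by rewrite !inE => /andP[ik ->]; rewrite (leq_trans ik kk).
have Rn st : R n st = lengths la st.1 st.2 by rewrite /R ul.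
have Rlt (k : 'I_n) : (R k (f k) < lengths la (f k).1 (f k).2)%N.
  by have := Rmono (f k) _ _ (ltn_ord k); rewrite RS eqxx addn1 Rn.
have Rpart (k : 'I_n) e : part (rows (wprefix f k.+1) e).
  exact/part_vwords/(vwords_wprefix _ _ un).
have exk b : exists k : 'I_n, (f k == box_step b) && (R k (f k) == box_pos b).
  have ex : exists k, (box_pos b < R k (box_step b))%N.
    by exists n; rewrite Rn box_pos_lt.
  (* The time sought is one less than the first at which the row is longer than [box_pos b]. *)
  case: (ex_minnP ex) => -[|k] lt kmin; first by rewrite /R wprefix0 in lt.
  have kn : (k < n)%N by apply: kmin; rewrite Rn box_pos_lt.
  have := kmin k; rewrite ltnn => /contraNF/(_ isT); rewrite ltnNge => /negbFE le.
  have := RS (Ordinal kn) (box_step b); rewrite /= => Rk; rewrite Rk in lt.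
  have E : f (Ordinal kn) == box_step b.
    by apply: contraTT lt => /negbTE->; rewrite addn0 -leqNgt.
  rewrite E addn1 ltnS in lt; exists (Ordinal kn).
  by rewrite E (eqP E) eqn_leq lt le.
pose T : filling la := [ffun b => odflt (box_pos b)
  [pick k | (f k == box_step b) && (R k (f k) == box_pos b)]].
have TP b : f (T b) = box_step b /\ R (T b) (f (T b)) = box_pos b.
  rewrite /T ffunE; case: pickP => [k /andP[/eqP ? /eqP ?] //|h].
  by have [k] := exk b; rewrite h.
have Tinj : injective T.
  move=> b c bc; have [bs bp] := TP b; have [cs cp] := TP c.
  by apply: box_eq; [rewrite -bs -cs bc | apply/val_inj; rewrite /= -bp -cp bc].
have Rinj (k k' : 'I_n) : f k = f k' -> R k (f k) = R k' (f k') -> k = k'.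
  move=> ff; have lt (i j : 'I_n) : f i = f j -> (i < j)%N -> (R i (f i) < R j (f j))%N.
    move=> fij ij; rewrite -fij; apply: leq_trans (Rmono _ _ _ ij).
    by rewrite RS eqxx addn1.
  move=> E; apply/val_inj; case: (ltngtP k k') => // /lt.
    by rewrite E ltnn => /(_ ff).
  by rewrite E ltnn => /(_ (esym ff)).
have Tsurj k : {b | T b = k}.
  have [b bs bp] := box_exists (Rlt k); exists b; have [bs' bp'] := TP b.
  by apply: Rinj; rewrite ?bp' // bs'.
have Ts : T \in SYT la.
  apply/SYTP; split.
  - exists (fun k => sval (Tsurj k)) => [b|k]; last exact: (svalP (Tsurj k)).
    by apply: Tinj; rewrite (svalP (Tsurj (T b))).
  - move=> b c bc; have [bs bp] := TP b; have [cs cp] := TP c.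
    rewrite -bp -cp bs cs bc => lt; rewrite ltnNge; apply/negP => /(Rmono (box_step c)).
    by rewrite leqNgt lt.
  - move=> b c bc pp rr; have [bs bp] := TP b; have [cs cp] := TP c.
    rewrite ltnNge leq_eqVlt; apply/negP => /predU1P[/val_inj/Tinj E|lt].
      by rewrite E ltnn in rr.
    have := partP _ (Rpart (T c) (box_step b).1) _ _ (ltnW rr).
    rewrite leqNgt => /negP; apply.
    have := Rmono (box_step b) _ _ lt; rewrite -{2}bs bp pp /R => le.
    rewrite (leq_ltn_trans le) // bc.
    by have := RS (T c) (box_step c); rewrite -{2}cs cp cs eqxx addn1 /R => ->.
exists T => //; rewrite /tab_word /wprefix; apply: eq_map => k.
have [b <-] := Tsurj k; rewrite tab_stepsE //; by have [] := TP b.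
Qed.

Lemma perm_tab_words : (0 < n)%N ->
  perm_eq [seq tab_word T | T <- enum (SYT la)]
          [seq u <- vwords n n | same_rows (lengths la) u].
Proof.
move=> n0; apply: uniq_perm.
- rewrite map_inj_in_uniq ?enum_uniq // => T T'; rewrite !mem_enum.
  exact: tab_word_inj.
- exact/filter_uniq/uniq_vwords.
move=> u; rewrite mem_filter; apply/mapP/andP => [[T]|[/same_rowsP ul uv]].
  rewrite mem_enum => Ts ->; split; last exact: tab_word_vwords.
  by apply/same_rowsP => e r; apply: rows_tab_word.
have [T Ts ->] := tab_word_surj n0 uv ul.
by exists T; rewrite ?mem_enum.
Qed.

End Tableaux.

(** * The order of B_n and the shuffle as an element of its group algebra *)

Lemma card_hyperoct n : #|hyperoct n| = (2 ^ n * n`!)%N.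
Proof.
pose g (p : {ffun 'I_n -> bool} * 'S_n) (x : signed n) : signed n :=
  (x.1 (+) p.1 x.2, p.2 x.2).
have g_inj p : injective (g p).
  move=> [b i] [c j] [/= E /perm_inj ij]; rewrite ij in E *.
  by congr pair; move: E; case: (p.1 j) (b) (c) => -[] [].
pose h p := perm (@g_inj p).
have h_inj : injective h.
  move=> [p s] [q t] E; have {}E x : g (p, s) x = g (q, t) x.
    by rewrite -[LHS](permE (@g_inj (p, s))) -[RHS](permE (@g_inj (q, t))) -/(h _) E.
  congr pair; first by apply/ffunP => i; have [] := E (false, i).
  by apply/permP => i; have [] := E (false, i).
have -> : hyperoct n = h @: setT.
  apply/setP => s; apply/idP/imsetP => [|[p _ ->]]; last first.
    by rewrite inE; apply/forallP => x; rewrite !permE /g /sopp /= addNb.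
  rewrite inE => /forallP so; have {}so x : s (sopp x) = sopp (s x) by apply/eqP.
  have t_inj : injective (fun i => (s (false, i)).2).
    move=> i j E; have [E1|E1] := eqVneq (s (false, i)).1 (s (false, j)).1.
      have /perm_inj [] // : s (false, i) = s (false, j).
      by rewrite [LHS]surjective_pairing E E1 -surjective_pairing.
    have /perm_inj [] // : s (false, i) = s (sopp (false, j)).
    rewrite so /sopp [LHS]surjective_pairing E; congr pair.
    by move: E1; case: (s _).1; case: (s _).1.
  exists ([ffun i => (s (false, i)).1], perm t_inj); rewrite ?inE //.
  apply/permP => -[b i]; rewrite permE /g /= ffunE permE; case: b.
    by rewrite -[(true, i)]/(sopp (false, i)) so.
  by rewrite -surjective_pairing.
rewrite card_imset // cardsT card_prod card_ffun card_bool card_ord.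
by rewrite -(card_Sn n) -cardsT.
Qed.

Section OST.
Variables (R : realFieldType) (w : nat -> R) (n : nat).
Notation alg := (galg R {perm signed n}).

(** The value of the sum of (w_j / j)(p_j + y_j) at the word; [~~ e] is the value of p_j and the
    source of the +1 for the first tableau. *)
Fixpoint word_weight (u : seq (step n)) : R :=
  if u is (e, r) :: u' then
    word_weight u' +
    w (size u').+1 / (size u').+1%:R * (cont R (beta (rows u' e)) r + (~~ e)%:R)
  else 0.

Lemma contE (la : 'I_n -> nat) r : cont R (beta la) r = (la r)%:R - r%:R.
Proof.
rewrite /cont /beta natrD natrB //.
rewrite -[X in _ + (X%:R - _) - _](prednK (leq_ltn_trans (leq0n r) (ltn_ord r))).
by rewrite -!natr1; ring.
Qed.

Lemma word_weight_cons (st : step n) u : word_weight (st :: u) = word_weight u +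
  w (size u).+1 / (size u).+1%:R *
    ((rows u st.1 st.2)%:R - st.2%:R + (~~ st.1)%:R).
Proof. by case: st => e r; rewrite /= contE. Qed.

Lemma size_wprefix (f : 'I_n -> step n) k : (k <= n)%N -> size (wprefix f k) = k.
Proof.
elim: k => [|k IH] kn; first by rewrite wprefix0.
by rewrite (wprefixS f (Ordinal kn)) /= IH // ltnW.
Qed.

Lemma word_weight_wprefix f k : (k <= n)%N -> word_weight (wprefix f k) =
  \sum_(i < n | (i < k)%N) w i.+1 / i.+1%:R *
    ((rows (wprefix f i) (f i).1 (f i).2)%:R - (f i).2%:R + (~~ (f i).1)%:R).
Proof.
elim: k => [|k IH] kn; first by rewrite wprefix0 big_pred0.
pose i := Ordinal kn; rewrite (wprefixS f i) word_weight_cons IH ?(ltnW kn) //.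
rewrite [in RHS](bigD1 i) ?ltnSn //= [RHS]addrC size_wprefix ?(ltnW kn) //.
congr (_ + _).
by apply: eq_bigl => j; rewrite ltnS andbC -(inj_eq val_inj) -ltn_neqAle.
Qed.

Lemma eig_tab_word la (T : filling la) : la \in bipartitions n -> T \in SYT la ->
  eig w T = (total_weight w n)^-1 * word_weight (tab_word T).
Proof.
move=> lab Ts; rewrite /eig; congr (_ * _).
rewrite word_weight_wprefix // [in RHS](eq_bigl predT) => [|i]; last exact: ltn_ord.
have [[g gT Tg] _ _] := SYTP _ Ts.
rewrite [RHS](reindex T) /=; last by exists g => b _; [apply: gT | apply: Tg].
rewrite big_sumType /=; congr (_ + _); apply: eq_bigr => b _.
  rewrite tab_stepsE // rows_tab_pos // /box_col /box_row /tab1 /=.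
  by rewrite -!natr1; ring.
rewrite tab_stepsE // rows_tab_pos // /box_col /box_row /tab2 /=.
by rewrite -!natr1; ring.
Qed.

Definition ostg : alg := [ffun g => ost w g].

(** The mass at the identity is split over [j]: each share joins [xi j] to form [pr R j false], and
    the reflections at [j] form [jm R j]. *)
Lemma ostgE : ostg = (total_weight w n)^-1 *:
  \sum_(j < n) (w j.+1 / j.+1%:R) *: (pr R j false + jm R j).
Proof.
apply/ffunP => g; rewrite ffunE galg_scaleE sum_ffunE.
have reflsE (j : 'I_n) : (jm R j) g =
    2^-1 * \sum_(i < n | (i < j)%N) ((g == transp i j)%:R + (g == neg_transp i j)%:R).
  rewrite /jm galg_scaleE sum_ffunE; congr (_ * _).
  transitivity (\sum_(b : bool) \sum_(i < n | (i < j)%N) (g == refl (b, i) j)%:R : R).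
    rewrite pair_big /=; apply: eq_big => // -[b i] _; rewrite ffunE.
    by [].
  by rewrite big_bool /= addrC -big_split.
have prE (j : 'I_n) : (pr R j false) g = 2^-1 * ((g == 1%g)%:R + (g == xi j)%:R).
  by rewrite /pr galg_scaleE expr0 scale1r ffunE galg1E !ffunE.
rewrite /ost mulrA mulr_sumr [RHS]mulr_sumr -!big_split /=; apply: eq_bigr => j _.
rewrite galg_scaleE [(pr R j false + jm R j) g]ffunE prE reflsE.
rewrite -mulr_suml /ost_rate !invfM.
ring.
Qed.

Lemma GZ_ostg : GZ n ostg (fun u => (total_weight w n)^-1 * word_weight u).
Proof.
rewrite ostgE; apply: GZ_scale.
suff H k : (k <= n)%N -> GZ k
    (\sum_(j < n | (j < k)%N) (w j.+1 / j.+1%:R) *: (pr R j false + jm R j))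
    word_weight.
  by have := H n (leqnn n); rewrite (eq_bigl predT) // => i; rewrite ltn_ord.
elim: k => [|k IH] kn.
  rewrite big_pred0 // -(scale0r 1); apply: (GZ_ext (GZ_scalar _ 0)) => u.
  by rewrite inE => /eqP->.
pose j := Ordinal kn; rewrite (bigD1 j) ?ltnSn //= addrC.
rewrite (eq_bigl (fun i : 'I_n => (i < k)%N)); last first.
  by move=> i; rewrite ltnS andbC -(inj_eq val_inj) -ltn_neqAle.
have P := GZ_pr_jm R j false 0; have X := GZ_jm R j 1.
rewrite expr0 mulr1 in P; rewrite expr1 in X.
have H := GZ_add (GZ_lift (IH (ltnW kn) : GZ j _ _))
  (GZ_scale (w k.+1 / k.+1%:R) (GZ_add P X)).
apply: (GZ_ext H) => u uk; have := size_vwords uk.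
case: u {uk} => // -[e r] u [su] /=; rewrite su expr1 expr0 mulr1.
by rewrite [_ + cont _ _ _]addrC; case: e.
Qed.

Lemma ost_supp : supp (hyperoct n) ostg.
Proof. by rewrite -hyp_fixn; apply: (GZ_supp GZ_ostg). Qed.

Lemma ost_matrixX m i j : (ost_matrix w n ^+ m) i j =
  (ostg ^+ m) ((enum_val i)^-1 * enum_val j)%g.
Proof.
elim: m i j => [|m IH] i j.
  rewrite !expr0 mxE galg1E ffunE -(inj_eq (mulgI (enum_val i))) mulKVg mulg1.
  by rewrite (inj_eq enum_val_inj) eq_sym.
rewrite !exprSr mxE galg_mulE.
have sX : supp (hyperoct n) (ostg ^+ m).
  exact: (suppX (H := hyperoct_group n) _ ost_supp).
rewrite (bigID (mem (hyperoct n))) /= [X in _ = _ + X]big1 ?addr0 => [|g gH]; last first.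
  by rewrite sX // mul0r.
rewrite (reindex_inj (mulgI (enum_val i)^-1)%g) /=.
rewrite (eq_bigl (mem (hyperoct n))) => [|g]; last first.
  by rewrite /= groupMl // groupV enum_valP.
rewrite [RHS]big_enum_val /=; apply: eq_bigr => k _.
rewrite IH mxE invMg invgK mulgA mulgK; congr (_ * _).
by rewrite [RHS]ffunE.
Qed.

(** All atoms of the distribution are their own inverses. *)
Lemma ost_matrix_tr : (ost_matrix w n)^T = ost_matrix w n.
Proof.
have nV (i j : 'I_n) : (i < j)%N -> (neg_transp i j)^-1%g = neg_transp i j.
  move=> ij; have ne : i != j by rewrite -(inj_eq val_inj) neq_ltn ij.
  apply/eqP; rewrite eq_invg_mul; apply/eqP/permP => x.
  rewrite permM !neg_transpE // perm1 /= tpermK.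
  case: x => b k /=; congr pair; rewrite -addbA.
  suff -> : (tperm i j k == i) || (tperm i j k == j) = (k == i) || (k == j).
    by rewrite addbb addbF.
  by rewrite !(can2_eq (tpermK i j) (tpermK i j)) tpermL tpermR orbC.
have tV (i j : 'I_n) : (transp i j)^-1%g = transp i j.
  apply/eqP; rewrite eq_invg_mul; apply/eqP/permP => -[b k].
  by rewrite permM !transpE perm1 /= tpermK.
have oV (g : {perm signed n}) : ost w g^-1%g = ost w g.
  rewrite /ost; congr (_ + _ + _).
  - by rewrite eq_invg1.
  - by apply: eq_bigr => j _; rewrite eqg_invLR tpermV.
  apply: eq_bigr => j _; apply: eq_bigr => i ij.
  by rewrite !eqg_invLR tV nV.
apply/matrixP => i j; rewrite !mxE -[LHS]oV invMg invgK.
by [].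
Qed.

(** The diagonal of a power is constant, so the trace is |B_n| times a value at 1; |B_n| clears the
    denominator of [prob] and leaves the number of words of the same shape. *)
Lemma trace_ost_matrix m : \tr (ost_matrix w n ^+ m) =
  \sum_(u <- vwords n n) (count (same_rows (rows u)) (vwords n n))%:R *
    ((total_weight w n)^-1 * word_weight u) ^+ m.
Proof.
rewrite /mxtrace (eq_bigr (fun=> (ostg ^+ m) 1%g)) => [|i _]; last first.
  by rewrite ost_matrixX mulVg.
rewrite sumr_const card_ord card_hyperoct.
rewrite (trace_GZ (leqnn n) (GZ_exp m (leqnn n) GZ_ostg)) -sumrMnl.
by apply: eq_big_seq => u un; rewrite -(prob_count R un) -[LHS]mulr_natl mulrA.
Qed.

End OST.

(** * Regrouping the words by shape *)

Lemma shape_word n u : u \in vwords n n -> exists la0,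
  forall la, (la \in bipartitions n) && same_rows (lengths la) u = (la == la0).
Proof.
move=> un; have le e i : (rows u e i < n.+1)%N.
  rewrite ltnS -[X in (_ <= X)%N](size_vwords un) -sum_rows (bigD1 e) //=.
  by rewrite (bigD1 i) //= -addnA leq_addr.
pose la0 : row_lengths n * row_lengths n :=
  ([ffun i => Ordinal (le false i)], [ffun i => Ordinal (le true i)]).
have laE e i : lengths la0 e i = rows u e i by rewrite /lengths; case: e; rewrite ffunE.
exists la0 => la; apply/andP/eqP => [[_ /same_rowsP h]|->].
  by case: la h => la1 la2 h; congr pair; apply/ffunP => i; rewrite ffunE;
    apply/val_inj; rewrite /= h.
split; last by apply/same_rowsP => e i; rewrite laE.
have lap e : part (lengths la0 e).
  by apply/partP => i j ij; rewrite !laE; move/partP: (part_vwords e un); apply.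
rewrite inE; apply/and3P; split.
- apply/forallP => i; apply/forallP => j; apply/implyP; exact/(partP _ (lap false)).
- apply/forallP => i; apply/forallP => j; apply/implyP; exact/(partP _ (lap true)).
have := sum_rows u; rewrite (size_vwords un) big_bool /= addnC => E.
rewrite -[X in _ == X]E; apply/eqP; congr (_ + _)%N; apply: eq_bigr => i _.
  exact: (laE false).
exact: (laE true).
Qed.

Theorem theorem4p4p2 (R : realFieldType) (n : nat) (w : nat -> R)
    (n_gt0 : (0 < n)%N) (w_gt0 : forall k : nat, (0 < k)%N -> 0 < w k) :
  char_poly (ost_matrix w n) =
    \prod_(la in bipartitions n)
      \prod_(T in SYT la) ('X - (eig w T)%:P) ^+ #|SYT la|.
Proof.
pose ev (u : seq (step n)) := (total_weight w n)^-1 * word_weight w u.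
pose mult la := count (same_rows (n := n) la) (vwords n n).
(* The expected spectrum: the value of each word, repeated as often as there are words of its
   shape. *)
pose s := flatten [seq nseq (mult (rows u)) (ev u) | u <- vwords n n].
rewrite (@char_poly_power_traces _ _ _ s (ost_matrix_tr w n)) => [|k]; last first.
  rewrite trace_ost_matrix big_flatten big_map; apply: eq_bigr => u _.
  by rewrite big_nseq iter_addr_0 mulr_natl.
rewrite big_flatten big_map.
(* By [shape_word] the inner product has exactly one factor; it is inserted so that words and shapes
   can be exchanged. *)
transitivity (\prod_(u <- vwords n n)
  \prod_(la in bipartitions n | same_rows (lengths la) u)
    ('X - (ev u)%:P) ^+ mult (rows u)).
  apply: eq_big_seq => u /shape_word[la0 lau].
  by rewrite (big_pred1 la0) // big_nseq -Monoid.iteropE.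
rewrite (exchange_big_dep (mem (bipartitions n))) => [|u la _ /andP[]//].
apply: eq_bigr => la; rewrite -[mem _ la]/(la \in _) => lab.
rewrite (eq_bigl (same_rows (lengths la))) => [|u]; last first.
  by rewrite lab.
rewrite -big_filter -(perm_big _ (perm_tab_words lab n_gt0)) /=.
rewrite big_map big_enum; apply: eq_bigr => T Ts.
rewrite (eig_tab_word w lab Ts); congr (_ ^+ _).
have -> : #|SYT la| = mult (lengths la).
  rewrite cardE -(size_map (@tab_word n la)) (perm_size (perm_tab_words lab n_gt0)).
  by rewrite size_filter.
have rT e i : rows (tab_word T) e i = lengths la e i by apply: rows_tab_word.
by apply: eq_count => u; apply/same_rowsP/same_rowsP => h e i; rewrite h rT.
Qed.
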